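(* Let $\Omega^+\subset\mathcal{A}^{\mathbb{N}}$ be a one-sided (half-line) subshift of finite type, $T_+:\Omega^+\to\Omega^+$ the left shift, and $\mu^+$ a $T_+$-invariant Borel probability measure which is fully supported on $\Omega^+$ and has the bounded distortion property. Let $v:\Omega^+\to\mathbb{R}$ be anti $\alpha$-Hölder for some $\alpha\in(0,\infty)$, continuous, bounded, and monotone with respect to the dictionary order on $\Omega^+$. Consider the family of half-line Schrödinger operators $[H_{\lambda,v,\omega}\psi]_n=\psi_{n-1}+\psi_{n+1}+\lambda v(T_+^n\omega)\psi_n$ on $\ell^2(\mathbb{N})$ with Dirichlet boundary condition $\psi_{-1}=0$, with Lyapunov exponent $L(E;\lambda)$. Then there exists $C_1=C_1(v)>0$ such that for any $\lambda>0$, $$L(E;\lambda)>\log\lambda-C_1\quad\text{for all }E\in\mathbb{R}.$$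
   Context: $\mathbb{N}=\{0,1,2,\dots\}$; $\mathcal{A}=\{0,1,\dots,\ell-1\}$ with $\ell\ge2$ an integer. A two-sided subshift of finite type $\Omega$ is the set of all $\omega\in\mathcal{A}^{\mathbb{Z}}$ none of whose subwords belongs to a given finite set of forbidden words of a fixed length; $\Omega^+=\{(\omega_n)_{n\ge0}:\omega\in\Omega\}$. $[T_+\omega]_n=\omega_{n+1}$. The metric is $d(\omega,\omega')=e^{-N(\omega,\omega')}$ for $\omega\neq\omega'$ (and $0$ if equal), where $N(\omega,\omega')=\max\{n\in\mathbb{N}:\omega_j=\omega'_j\text{ for all }0\le j<n\}$. Dictionary order: for distinct $\omega,\omega'$, $\omega<\omega'$ iff $\omega_{N(\omega,\omega')}<\omega'_{N(\omega,\omega')}$. Cylinders: $[n;i_0\dots i_k]^+=\{\omega\in\Omega^+:\omega_{n+l}=i_l,\ 0\le l\le k\}$, $n\in\mathbb{N}$. Bounded distortion property: there is $\gamma\ge1$ such that whenever $l>n+k$ and $[n;j_0\dots j_k]^+\cap[l;i_0\dots i_m]^+\ne\varnothing$, $$\gamma^{-1}\le\frac{\mu^+([n;j_0\dots j_k]^+\cap[l;i_0\dots i_m]^+)}{\mu^+([n;j_0\dots j_k]^+)\,\mu^+([l;i_0\dots i_m]^+)}\le\gamma.$$ Anti $\alpha$-Hölder: there is $H>0$ with $|v(\omega)-v(\tilde\omega)|\ge H\,d(\omega,\tilde\omega)^\alpha$ for all $\omega,\tilde\omega\in\Omega^+$. Lyapunov exponent: with $A^{(E-\lambda v)}(\omega)=\begin{pmatrix}E-\lambda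 v(\omega)&-1\\1&0\end{pmatrix}$ and $A^{(E-\lambda v)}_n(\omega)=A^{(E-\lambda v)}(T_+^{n-1}\omega)\cdots A^{(E-\lambda v)}(\omega)$, $$L(E;\lambda)=\lim_{n\to\infty}\frac1n\int_{\Omega^+}\log\|A^{(E-\lambda v)}_n(\omega)\|\,d\mu^+(\omega).$$
   Formalization: The measure μ^+ is additionally assumed to have no atoms; without this the claim fails, e.g. for Ω^+={000…}, μ^+ the point mass and v=0, where L(0;λ)=0 for every λ. *)

(* Defs.v *)
From HB Require Import structures.
From mathcomp Require Import all_boot all_order all_algebra.
From mathcomp Require Import all_classical all_reals all_analysis.

Set Implicit Arguments.
Unset Strict Implicit.
Unset Printing Implicit Defensive.

Import Order.TTheory GRing.Theory Num.Theory.
Import numFieldNormedType.Exports.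

Local Open Scope classical_set_scope.
Local Open Scope ring_scope.

Section sequences.
Context {ell : nat}.
Implicit Types w : nat -> 'I_ell.

Definition agree w w' (n : nat) : Prop :=
  forall j, (j < n)%N -> w j = w' j.

(* The maximum of {n | agree w w' n}; it exists exactly when w <> w', and the
   value is 0 (and never used) when w = w'. *)
Definition sep_index w w' : nat :=
  xget 0%N [set n | agree w w' n /\ forall m, agree w w' m -> (m <= n)%N].

Definition seq_dist {R : realType} w w' : R :=
  if `[< w = w' >] then 0 else expR (- (sep_index w w')%:R).

Definition dict_lt w w' : Prop :=
  w <> w' /\ (w (sep_index w w') < w' (sep_index w w'))%N.

Lemma agree_sym w w' n : agree w w' n -> agree w' w n.
Proof. by move=> h j jn; rewrite h. Qed.

Lemma sep_indexP w w' : w <> w' ->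
  agree w w' (sep_index w w') /\
  forall m, agree w w' m -> (m <= sep_index w w')%N.
Proof.
move=> neq; rewrite /sep_index.
suff [n Pn] : exists n, agree w w' n /\ forall m, agree w w' m -> (m <= n)%N.
  by case: xgetP => [_ _ //|/(_ n)].
have exd : exists n, w n != w' n.
  apply/not_existsP => h; apply: neq; apply/funext => n.
  by apply/eqP; apply: contrapT => /negP; exact: h.
case: (ex_minnP exd) => n nd nmin; exists n; split.
- move=> j jn; apply/eqP; apply: contraTT jn => /nmin.
  by rewrite -leqNgt.
- move=> m am; rewrite leqNgt; apply/negP => nm.
  by move: nd; rewrite am// eqxx.
Qed.

Lemma seq_distxx (R : realType) w : seq_dist w w = 0 :> R.
Proof. by rewrite /seq_dist asboolT. Qed.

Lemma seq_dist_ge0 (R : realType) w w' : 0 <= seq_dist w w' :> R.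
Proof. by rewrite /seq_dist; case: asboolP => // _; exact: expR_ge0. Qed.

Lemma seq_dist_positivity (R : realType) w w' :
  seq_dist w w' = 0 :> R -> w = w'.
Proof.
rewrite /seq_dist; case: asboolP => // _ /eqP.
by rewrite gt_eqF// expR_gt0.
Qed.

Lemma sep_index_sym w w' : sep_index w w' = sep_index w' w.
Proof.
have [->//|neq] := pselect (w = w').
have [a1 m1] := sep_indexP neq.
have [a2 m2] := sep_indexP (nesym neq).
by apply/eqP; rewrite eqn_leq m2 ?m1//; exact: agree_sym.
Qed.

Lemma seq_dist_sym (R : realType) w w' : seq_dist w w' = seq_dist w' w :> R.
Proof.
by rewrite /seq_dist sep_index_sym; congr (if _ then _ else _);
  apply/asbool_equiv_eq; split.
Qed.

Lemma seq_dist_ultra (R : realType) w2 w1 w3 :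
  seq_dist w1 w3 <= Num.max (seq_dist w1 w2) (seq_dist w2 w3) :> R.
Proof.
have [->|n12] := pselect (w1 = w2); first by rewrite le_max lexx orbT.
have [->|n23] := pselect (w2 = w3); first by rewrite le_max lexx.
have [->|n13] := pselect (w1 = w3).
  by rewrite seq_distxx le_max seq_dist_ge0.
rewrite /seq_dist !asboolF// le_max !ler_expR !lerN2 !ler_nat.
have [a12 _] := sep_indexP n12; have [a23 _] := sep_indexP n23.
have [_ m13] := sep_indexP n13.
rewrite -geq_min; apply: m13 => j; rewrite leq_min => /andP[j1 j2].
by rewrite a12// a23.
Qed.

Lemma seq_dist_triangle (R : realType) w2 w1 w3 :
  seq_dist w1 w3 <= seq_dist w1 w2 + seq_dist w2 w3 :> R.
Proof.
rewrite (le_trans (seq_dist_ultra R w2 w1 w3))// ge_max.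
by rewrite lerDl lerDr !seq_dist_ge0.
Qed.

End sequences.

Section shift_of_finite_type.
Context {ell k : nat}.
Implicit Type F : {set k.-tuple 'I_ell}.

Definition sft F : set (int -> 'I_ell) :=
  [set w | forall n : int, [tuple w (n + i%:Z) | i < k] \notin F].

Definition sft_plus F : set (nat -> 'I_ell) :=
  [set (fun n : nat => w n%:Z) | w in sft F].

Lemma sft_plus_shift F (w : nat -> 'I_ell) :
  sft_plus F w -> sft_plus F (fun n => w n.+1).
Proof.
move=> [u Fu <-]; exists (fun n => u (n + 1)).
  move=> n /=; rewrite [X in X \notin _](_ : _ =
      [tuple u (n + 1 + i%:Z) | i < k]); last first.
    by apply: eq_from_tnth => i; rewrite !tnth_mktuple addrAC.
  exact: Fu.
by apply/funext => n; rewrite -addn1 PoszD.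
Qed.

End shift_of_finite_type.

(* The space Omega^+ as a type. The parameter R only records the field in which
   the distance takes its values; F0 makes the type pointed, as required by
   measurableType (it holds as soon as Omega^+ carries a probability measure). *)
Definition half_line (R : realType) (ell k : nat) (F : {set k.-tuple 'I_ell})
  (F0 : sft_plus F !=set0) : Type := {w : nat -> 'I_ell | sft_plus F w}.

Section half_line_structures.
Context {R : realType} {ell k : nat} {F : {set k.-tuple 'I_ell}}.
Context {F0 : sft_plus F !=set0}.
Local Notation X := (half_line R F0).

Definition letter (w : X) : nat -> 'I_ell := sval w.

Definition half_line_dist (w w' : X) : R := seq_dist (letter w) (letter w').

Let distxx (w : X) : half_line_dist w w = 0.
Proof. exact: seq_distxx. Qed.

Let dist_positivity (w w' : X) : half_line_dist w w' = 0 -> w = w'.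
Proof.
case: w w' => [w Fw] [w' Fw'] /seq_dist_positivity /= ww'.
by subst w'; congr exist; exact: Prop_irrelevance.
Qed.

Let dist_sym (w w' : X) : half_line_dist w w' = half_line_dist w' w.
Proof. exact: seq_dist_sym. Qed.

Let dist_triangle (w2 w1 w3 : X) :
  half_line_dist w1 w3 <= half_line_dist w1 w2 + half_line_dist w2 w3.
Proof. exact: seq_dist_triangle. Qed.

Let half_line_point : X := exist _ (sval (cid F0)) (svalP (cid F0)).

HB.instance Definition _ := gen_eqMixin X.
HB.instance Definition _ := gen_choiceMixin X.
HB.instance Definition _ := isPointed.Build X half_line_point.
HB.instance Definition _ :=
  isMetric.Build R X distxx dist_positivity dist_sym dist_triangle.
HB.instance Definition _ :=
  Measurable.copy X (g_sigma_algebraType (@open X)).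

Definition shift_plus (w : X) : X :=
  exist _ (fun n => letter w n.+1) (sft_plus_shift (svalP w)).

Definition cylinder (n k' : nat) (i : k'.+1.-tuple 'I_ell) : set X :=
  [set w | forall l : 'I_k'.+1, letter w (n + l) = tnth i l].

Definition anti_holder (alpha : R) (v : X -> R) : Prop :=
  exists2 H : R, 0 < H & forall w w', H * mdist w w' `^ alpha <= `|v w - v w'|.

Definition dict_monotone (v : X -> R) : Prop :=
  (forall w w', dict_lt (letter w) (letter w') -> v w <= v w') \/
  (forall w w', dict_lt (letter w) (letter w') -> v w' <= v w).

Implicit Type mu : probability X R.

Definition shift_invariant mu : Prop :=
  forall A : set X, measurable A -> mu (shift_plus @^-1` A) = mu A.

Definition fully_supported mu : Prop :=
  forall U : set X, open U -> U !=set0 -> (0 < mu U)%E.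

Definition bounded_distortion mu : Prop :=
  exists2 gamma : R, 1 <= gamma &
  forall (n l j_len i_len : nat) (j : j_len.+1.-tuple 'I_ell)
    (i : i_len.+1.-tuple 'I_ell),
    (n + j_len < l)%N -> cylinder n j `&` cylinder l i !=set0 ->
    gamma^-1 <= fine (mu (cylinder n j `&` cylinder l i)) /
                (fine (mu (cylinder n j)) * fine (mu (cylinder l i))) <= gamma.

(* For an invariant, fully supported mu with bounded distortion, this says that
   Omega^+ has no isolated point. It excludes degenerate subshifts, on which no
   bound L(E; lambda) > ln lambda - C can hold: for Omega^+ = {000...}, the
   exponent vanishes at E = lambda * v(000...) for every lambda. *)
Definition nonatomic mu : Prop := forall w : X, mu [set w] = 0%E.

End half_line_structures.

Section lyapunov_exponent.
Context {R : realType}.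

Definition euclidean_norm (n : nat) (x : 'cV[R]_n) : R :=
  Num.sqrt (\sum_i x i 0 ^+ 2).

Definition operator_norm (n : nat) (A : 'M[R]_n) : R :=
  sup [set euclidean_norm (A *m x) | x in [set x | euclidean_norm x = 1]].

Context {ell k : nat} {F : {set k.-tuple 'I_ell}} {F0 : sft_plus F !=set0}.
Local Notation X := (half_line R F0).

Definition transfer_matrix (v : X -> R) (lambda E : R) (w : X) : 'M[R]_2 :=
  \matrix_(i, j)
    nth 0 (nth [::] [:: [:: E - lambda * v w; -1];
                        [:: 1;                 0]] i) j.

Fixpoint cocycle (v : X -> R) (lambda E : R) (n : nat) (w : X) : 'M[R]_2 :=
  if n is m.+1
  then transfer_matrix v lambda E (iter m shift_plus w) *m cocycle v lambda E m w
  else 1%:M.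

(* The limit exists, by subadditivity, for every invariant mu and every
   continuous v. *)
Definition lyapunov (mu : probability X R) (v : X -> R) (lambda E : R) : R :=
  limn (fun n => n%:R^-1 *
    \int[mu]_(w in setT) ln (operator_norm (cocycle v lambda E n w))).

End lyapunov_exponent.

(* Main.v *)
Require Import Defs.
From HB Require Import structures.
From mathcomp Require Import all_boot all_order all_algebra.
From mathcomp Require Import all_classical all_reals all_analysis.
From mathcomp Require Import measurable_realfun.
From mathcomp Require Import ring lra zify.
Import Order.TTheory GRing.Theory Num.Theory.
Import numFieldNormedType.Exports.
Local Open Scope classical_set_scope.
Local Open Scope ring_scope.

Set Implicit Arguments.
Unset Strict Implicit.
Unset Printing Implicit Defensive.

(** The first column of the n-step transfer matrix is (P_n, P_(n-1)), where
    P_n is the Dirichlet determinant det (E - H) of the operator on the sites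
    0, ..., n-1.  Hence ln of the norm is at least the sum over j < n of
    ln |t_(j+1)|, with t_(j+1) = P_(j+1) / P_j = E - lambda v(T^j w) + u_j and
    u_j = - P_(j-1) / P_j.  It is enough that t_(j+1) is rarely much smaller
    than lambda, with a bound that depends neither on j, nor on lambda, nor on
    E: if the probability of |t_(j+1)| < lambda (H/2) e^(- alpha r) is at most
    K e^(- kappa r) for all r, then summing over r and j bounds the mean growth
    below by n (ln (lambda H/2) - alpha K / (1 - e^(- kappa))).

    The bound comes from oscillation theory.  Let N_j be the number of negative
    entries among t_1, ..., t_j.  Fix the first j letters of w and let the tail
    increase in the dictionary order.  All the potentials v(T^i w), i <= j, then
    move in the same direction, and the pair (N_j, - u_j) moves monotonically
    for the lexicographic order ([sturm_monotone]): the point t_j only turns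
    one way around the projective line, and N_j counts its turns.  On the part
    of the cylinder where N_j is constant, two points with small t_(j+1) have
    nearby values of v(T^j .), hence, v being anti-Hoelder, tails that agree for
    r letters ([small_ratio_agree]).  The points of small ratio with a given N_j
    therefore lie in one cylinder with r further letters, of relative measure
    O(e^(- kappa r)).

    What remains is to count the values taken by N_j on a cylinder.  The
    oscillation of N grows by at most one at each step, while it is shared among
    the subcylinders when one more letter is fixed ([index_gapsS],
    [index_gaps_children]).  Bounded distortion and the absence of atoms make
    the measure of cylinders decay exponentially, uniformly inside every
    cylinder ([prob_cyl_decay]), so that the mean of the oscillation stays
    bounded ([mean_index_gaps]) and the required estimate follows
    ([prob_small_ratio]).  The limit defining the exponent exists by
    subadditivity ([fekete_cvg], [mean_growthD]). *)

(** * The operator norm *)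

Section operator_norm.
Context {R : realType}.

Local Notation enorm := (@euclidean_norm R _).
Local Notation opnorm := (@operator_norm R _).

Lemma enorm_ge0 n (x : 'cV[R]_n) : 0 <= enorm x.
Proof. exact: sqrtr_ge0. Qed.

Lemma enorm_sqr n (x : 'cV[R]_n) : enorm x ^+ 2 = \sum_i x i 0 ^+ 2.
Proof. by rewrite sqr_sqrtr// sumr_ge0// => i _; exact: sqr_ge0. Qed.

Lemma enormZ n (a : R) (x : 'cV[R]_n) : enorm (a *: x) = `|a| * enorm x.
Proof.
rewrite /euclidean_norm -sqrtr_sqr -sqrtrM ?sqr_ge0// mulr_sumr.
by congr Num.sqrt; apply: eq_bigr => i _; rewrite mxE exprMn.
Qed.

Lemma ler_entry_enorm n (x : 'cV[R]_n) i : `|x i 0| <= enorm x.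
Proof.
rewrite -(@ler_pXn2r _ 2)// ?nnegrE ?enorm_ge0// enorm_sqr real_normK ?num_real//.
by rewrite (bigD1 i)//= lerDl sumr_ge0// => j _; exact: sqr_ge0.
Qed.

Lemma enorm_le_sum n (x : 'cV[R]_n) : enorm x <= \sum_i `|x i 0|.
Proof.
have s0 : 0 <= \sum_i `|x i 0| by rewrite sumr_ge0.
rewrite -(@ler_pXn2r _ 2)// ?nnegrE ?enorm_ge0// enorm_sqr expr2 mulr_suml.
apply: ler_sum => i _; rewrite -[leLHS]real_normK ?num_real// expr2.
by rewrite ler_wpM2l// (bigD1 i)//= lerDl sumr_ge0.
Qed.

Lemma enorm_eq0 n (x : 'cV[R]_n) : enorm x = 0 -> x = 0.
Proof.
move=> x0; apply/matrixP => i j; rewrite ord1 mxE; apply/eqP.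
by rewrite -normr_le0 -x0; exact: ler_entry_enorm.
Qed.

Lemma enorm_delta n (j : 'I_n) : enorm (delta_mx j 0) = 1.
Proof.
rewrite /euclidean_norm (bigD1 j)//= mxE !eqxx/= big1 ?addr0 ?expr1n ?sqrtr1//.
by move=> i /negbTE ij; rewrite mxE ij /= expr0n.
Qed.

Section square.
Context {n : nat}.
Implicit Types A B : 'M[R]_n.+1.

Lemma enorm_mulmx_le_sum A (x : 'cV[R]_n.+1) : enorm x = 1 ->
  enorm (A *m x) <= \sum_i \sum_j `|A i j|.
Proof.
move=> x1; rewrite (le_trans (enorm_le_sum _))// ler_sum// => i _.
rewrite mxE (le_trans (ler_norm_sum _ _ _))// ler_sum// => j _.
by rewrite normrM ler_piMr// -x1 ler_entry_enorm.
Qed.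

Lemma has_sup_opnorm A :
  has_sup [set enorm (A *m x) | x in [set x : 'cV[R]_n.+1 | enorm x = 1]].
Proof.
split; first by exists (enorm (A *m delta_mx 0 0)), (delta_mx 0 0);
  rewrite //= enorm_delta.
exists (\sum_i \sum_j `|A i j|) => _ [x /= x1 <-].
exact: enorm_mulmx_le_sum.
Qed.

Lemma opnorm_le_sum A : opnorm A <= \sum_i \sum_j `|A i j|.
Proof.
apply: ge_sup; first by case: (has_sup_opnorm A).
by move=> _ [x /= x1 <-]; exact: enorm_mulmx_le_sum.
Qed.

Lemma enorm_mulmx A (x : 'cV[R]_n.+1) : enorm (A *m x) <= opnorm A * enorm x.
Proof.
have [x0|x0] := eqVneq (enorm x) 0.
  by rewrite x0 mulr0 (enorm_eq0 x0) mulmx0 -(scale0r 0) enormZ normr0 mul0r.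
have x_gt0 : 0 < enorm x by rewrite lt_def x0 enorm_ge0.
rewrite -ler_pdivrMr// mulrC -[X in X * _]ger0_norm ?invr_ge0 ?enorm_ge0//.
rewrite -enormZ scalemxAr; apply: ub_le_sup; first by case: (has_sup_opnorm A).
exists ((enorm x)^-1 *: x) => //=.
by rewrite enormZ ger0_norm ?invr_ge0 ?enorm_ge0// mulVf.
Qed.

Lemma opnorm_col A j : enorm (col j A) <= opnorm A.
Proof. by rewrite colE (le_trans (enorm_mulmx _ _))// enorm_delta mulr1. Qed.

Lemma opnorm_ge0 A : 0 <= opnorm A.
Proof. exact: le_trans (enorm_ge0 _) (opnorm_col A 0). Qed.

Lemma ler_entry_opnorm A i j : `|A i j| <= opnorm A.
Proof.
rewrite (le_trans _ (opnorm_col A j))// (le_trans _ (ler_entry_enorm _ i))//.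
by rewrite mxE.
Qed.

Lemma opnormM A B : opnorm (A *m B) <= opnorm A * opnorm B.
Proof.
apply: ge_sup; first by case: (has_sup_opnorm (A *m B)).
move=> _ [x /= x1 <-]; rewrite -mulmxA (le_trans (enorm_mulmx _ _))//.
by rewrite ler_wpM2l ?opnorm_ge0// (le_trans (enorm_mulmx _ _))// x1 mulr1.
Qed.

(** This exhibits the operator norm as a supremum of functions continuous in
    the matrix, hence as lower semicontinuous, which is how it is measured. *)
Lemma lt_opnorm A (c : R) :
  (c < opnorm A) <-> exists2 x : 'cV[R]_n.+1, enorm x = 1 & c < enorm (A *m x).
Proof.
split=> [|[x x1 cx]]; last first.
  by rewrite (lt_le_trans cx)// (le_trans (enorm_mulmx _ _))// x1 mulr1.
move=> /(sup_gt (has_sup_opnorm A).1) [_ [x /= x1 <-] cx].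
by exists x.
Qed.

End square.

(** By Hadamard's inequality the determinant is at most the product of the norms
    of the two columns, and each of these is at most the operator norm. *)
Lemma opnorm_ge1 (A : 'M[R]_2) : \det A = 1 -> 1 <= opnorm A.
Proof.
rewrite (expand_det_row _ 0) !big_ord_recl big_ord0 /cofactor !det_mx11 !mxE /=.
rewrite !expr0 expr1 addr0 mul1r mulN1r mulrN => detA.
rewrite -(@ler_pXn2r _ 4)// ?nnegrE ?opnorm_ge0// expr1n.
have q j : enorm (col j A) ^+ 2 <= opnorm A ^+ 2.
  by rewrite ler_pXn2r ?nnegrE ?opnorm_ge0 ?enorm_ge0// opnorm_col.
have -> : opnorm A ^+ 4 = opnorm A ^+ 2 * opnorm A ^+ 2 by rewrite -exprD.
apply: le_trans (ler_pM (sqr_ge0 _) (sqr_ge0 _) (q 0) (q 1)).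
rewrite !enorm_sqr !big_ord_recl !big_ord0 !mxE !addr0.
have i1 : lift ord0 ord0 = 1 :> 'I_2 by exact: val_inj.
have i0 : lift (lift ord0 ord0) 0 = 0 :> 'I_2 by exact: val_inj.
have i1' : lift 0 0 = 1 :> 'I_2 by exact: val_inj.
move: detA; rewrite i0 ?i1' ?i1 -[ord0]/(0 : 'I_2) => detA.
rewrite -[leLHS](expr1n _ 2) -detA -subr_ge0.
set a := A 0 0; set b := A 0 1; set c := A 1 0; set d := A 1 1.
suff -> : (a ^+ 2 + c ^+ 2) * (b ^+ 2 + d ^+ 2) - (a * d - b * c) ^+ 2 =
  (a * b + c * d) ^+ 2 by exact: sqr_ge0.
by ring.
Qed.

End operator_norm.

(** * Subadditive sequences and geometric bounds *)

(** Fekete's lemma: writing n = q m + r bounds a_n / n by a_m / m up to an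
    error that vanishes with n, so the limit is the infimum of the a_m / m. *)
Lemma fekete_cvg (R : realType) (a : nat -> R) :
  (forall n, 0 <= a n) -> (forall m n, a (m + n)%N <= a m + a n) ->
  cvgn (fun n => n%:R^-1 * a n).
Proof.
move=> a0 aD.
have aM q m r : a (q * m + r)%N <= q%:R * a m + a r.
  elim: q => [|q IH]; first by rewrite mul0n add0n mul0r add0r.
  rewrite mulSn -addnA (le_trans (aD _ _))// -natr1 mulrDl mul1r -addrA.
  by rewrite [leRHS]addrC -addrA lerD2l addrC.
pose S := [set n.+1%:R^-1 * a n.+1 | n in [set: nat]].
have S0 : S !=set0 by exists (1^-1 * a 1), 0%N.
have Slb : has_lbound S.
  by exists 0 => _ [n _ <-]; rewrite mulr_ge0// invr_ge0.
apply: (@cvgP _ _ (inf S)); apply/cvgrPdist_le => e e0.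
have [_ [m _ <-] ame] := inf_adherent (divr_gt0 e0 (ltr0Sn R 1)) (conj S0 Slb).
pose K := \sum_(r < m.+1) a r.
have aK r : (r < m.+1)%N -> a r <= K.
  move=> rm; rewrite /K (bigD1 (Ordinal rm))//= lerDl sumr_ge0//.
near=> n.
have n0 : (0 < n)%N by near: n; exact: nbhs_infty_gt.
have nR : 0 < n%:R :> R by rewrite ltr0n.
have nK : 2 / e * K <= n%:R by near: n; exact: nbhs_infty_ger.
rewrite ler_distlC; apply/andP; split.
  rewrite (@le_trans _ _ (inf S))//; first by rewrite gerBl ltW.
  by apply: (ge_inf Slb); exists n.-1 => //; rewrite prednK.
rewrite mulrC ler_pdivrMr//.
have := aM (n %/ m.+1)%N m.+1 (n %% m.+1)%N; rewrite -divn_eq => /le_trans; apply.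
have : (n %/ m.+1)%:R * a m.+1 <= n%:R * (m.+1%:R^-1 * a m.+1).
  rewrite mulrA ler_wpM2r// ler_pdivlMr ?ltr0n// -natrM ler_nat.
  exact: leq_divM.
have := aK _ (ltn_pmod n (ltn0Sn m)).
have : K <= n%:R * (e / 2).
  have -> : K = (2 / e * K) * (e / 2) by field; rewrite gt_eqF.
  by rewrite ler_wpM2r// divr_ge0// ltW.
have : n%:R * (m.+1%:R^-1 * a m.+1) <= n%:R * (inf S + e / 2).
  by rewrite ler_wpM2l ?ler0n// ltW.
rewrite (mulrDr _ (inf S)) mulrDl.
move: (inf S) (m.+1%:R^-1) (n%:R : R) => *; lra.
Unshelve. all: by end_near. Qed.

Lemma nneseries_geometric (R : realType) (K q : R) (a : nat -> \bar R) :
  0 <= K -> 0 <= q < 1 ->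
  (forall r, 0 <= a r <= (K * q ^+ r)%:E)%E ->
  (\sum_(r <oo) a r <= (K / (1 - q))%:E)%E.
Proof.
move=> K0 /andP[q0 q1] aK; have q1' : 0 < 1 - q by rewrite subr_gt0.
apply: lime_le; first by apply: is_cvg_nneseries => r _ _; have /andP[] := aK r.
apply: nearW => N.
apply: (@le_trans _ _ (\sum_(0 <= r < N) (K * q ^+ r)%:E)%E).
  by apply: lee_sum => r _; have /andP[] := aK r.
rewrite sumEFin lee_fin -mulr_sumr big_mkord ler_wpM2l//.
rewrite -[leRHS]div1r ler_pdivlMr// mulrC.
have -> : (1 - q) * (\sum_(i < N) q ^+ i) = 1 - q ^+ N.
  by rewrite -[RHS]opprB subrX1 -mulNr opprB.
by rewrite gerBl exprn_ge0.
Qed.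

(** * Sturm oscillation for a Jacobi recursion *)

Section sturm.
Context {R : realType}.
Implicit Types c d : nat -> R.

(** The pair (P_n, P_(n-1)) of consecutive determinants of the Jacobi matrix
    with diagonal c and off-diagonal entries -1, started from P_(-1) = 0. *)
Fixpoint sturm c n : R * R :=
  if n is m.+1 then (c m * (sturm c m).1 - (sturm c m).2, (sturm c m).1)
  else (1, 0).

Definition nonvanishing c n := forall j, (j <= n)%N -> (sturm c j).1 != 0.

Fixpoint sign_changes c n : nat :=
  if n is m.+1
  then sign_changes c m + ((sturm c m.+1).1 / (sturm c m).1 < 0)%R else 0.

(** The Riccati variable u_n.  It is the quantity that adds to c n in the ratio
    P_(n+1) / P_n ([sturm_ratio]), and it is minus the inverse of the
    preceding ratio ([riccatiS]). *)
Definition riccati c n : R := - ((sturm c n).2 / (sturm c n).1).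

Lemma nonvanishingS c n : nonvanishing c n.+1 -> nonvanishing c n.
Proof. by move=> gc j jn; apply: gc; rewrite (leq_trans jn). Qed.

Lemma sturm_ratio c n : nonvanishing c n ->
  (sturm c n.+1).1 / (sturm c n).1 = c n + riccati c n.
Proof.
by move=> /(_ n (leqnn n)) g /=; rewrite mulrBl mulfK.
Qed.

Lemma riccatiS c n :
  riccati c n.+1 = - ((sturm c n.+1).1 / (sturm c n).1)^-1.
Proof. by rewrite /riccati invf_div. Qed.

Lemma sign_changes_leq c n : (sign_changes c n <= n)%N.
Proof.
elim: n => //= n IH; rewrite -[n.+1]addn1 leq_add//; exact: leq_b1.
Qed.

(** Sturm comparison.  As the diagonal decreases, every ratio t_(j+1) = c_j +
    u_j decreases, and so does the next u = - 1 / t as long as t keeps its sign;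
    when t crosses 0 from above, u jumps from minus to plus infinity, but then
    the number of sign changes goes up by one.  Ordering first by sign changes
    and then by u makes the motion monotone through the jump. *)
Lemma sturm_monotone c d n : (forall j, (j < n)%N -> d j <= c j) ->
  nonvanishing c n -> nonvanishing d n ->
  (sign_changes c n < sign_changes d n)%N \/
  sign_changes c n = sign_changes d n /\ riccati d n <= riccati c n.
Proof.
elim: n => [|n IH] dc gc gd; first by right; rewrite /riccati /= !mul0r.
have {}IH := IH (fun j jn => dc j (ltnW jn)) (nonvanishingS gc) (nonvanishingS gd).
have tc0 : (sturm c n.+1).1 / (sturm c n).1 != 0.
  by rewrite mulf_neq0 ?invr_neq0// gc.
have td0 : (sturm d n.+1).1 / (sturm d n).1 != 0.
  by rewrite mulf_neq0 ?invr_neq0// gd.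
rewrite !riccatiS [sign_changes c _]/= [sign_changes d _]/=.
move: tc0 td0.
rewrite -[(c n * _ - _)]/(sturm c n.+1).1 -[(d n * _ - _)]/(sturm d n.+1).1.
rewrite !sturm_ratio; [|exact: nonvanishingS|exact: nonvanishingS].
move: {dc}(dc n (ltnSn n)) IH.
move: (sign_changes c n) (sign_changes d n) (c n) (d n) (riccati c n).
move: (riccati d n) => ud Nc Nd cn dn uc dcn IH tc0 td0.
rewrite lerN2.
have [tc|tc] := ltP (cn + uc) 0; have [td|td] := ltP (dn + ud) 0;
  rewrite ?addn1 ?addn0.
- case: IH => [|[-> ucd]]; [by left|right; split=> //].
  by rewrite lef_nV2// lerD.
- case: IH => [|[_ ucd]]; last by exfalso; lra.
  rewrite leq_eqVlt => /predU1P[<-|]; last by left.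
  right; split=> //; rewrite (@le_trans _ _ 0)//.
    by rewrite invr_le0 ltW.
  by rewrite invr_ge0.
- by case: IH => [cd|[-> _]]; left => //; exact: ltnW.
- case: IH => [|[-> ucd]]; [by left|right; split=> //].
  by rewrite lef_pV2 ?lerD// posrE lt_def ?tc0 ?td0.
Qed.

End sturm.

(** * Words, cylinders and the topology of the half-line subshift *)

Section half_line_topology.
Context {R : realType} {ell k : nat} {F : {set k.-tuple 'I_ell}}.
Context {F0 : sft_plus F !=set0}.
Local Notation X := (half_line R F0).
Local Notation T := (@shift_plus R ell k F F0).
Implicit Types (w : X) (s r : seq 'I_ell).

Definition prefix_word n w : seq 'I_ell := mkseq (letter w) n.

Definition cyl s : set X := [set w | prefix_word (size s) w = s].

Lemma letter_inj w w' : letter w = letter w' -> w = w'.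
Proof.
case: w w' => [w Fw] [w' Fw'] /= ww'; rewrite /letter/= in ww'.
by subst w'; congr exist; exact: Prop_irrelevance.
Qed.

Lemma letter_iter n w j : letter (iter n T w) j = letter w (n + j).
Proof. by elim: n j => //= n IH j; rewrite IH addnS. Qed.

Lemma agree_prefix n w w' :
  agree (letter w) (letter w') n <-> prefix_word n w = prefix_word n w'.
Proof.
split=> [ag|e j jn].
  apply: (@eq_from_nth _ (letter w 0)); rewrite !size_mkseq// => j jn.
  by rewrite !nth_mkseq// ag.
by have := congr1 (nth (letter w 0) ^~ j) e; rewrite !nth_mkseq.
Qed.

Lemma prefix_wordD n m w :
  prefix_word (n + m) w = prefix_word n w ++ prefix_word m (iter n T w).
Proof.
rewrite /prefix_word /mkseq iotaD map_cat add0n; congr (_ ++ _).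
rewrite -{1}(addn0 n) iotaDl -map_comp.
by apply: eq_map => j /=; rewrite letter_iter.
Qed.

Lemma cyl_cat s r : cyl (s ++ r) = cyl s `&` iter (size s) T @^-1` cyl r.
Proof.
apply/seteqP; split=> w; rewrite /cyl /= size_cat prefix_wordD.
  move/eqP; rewrite eqseq_cat; last by rewrite size_mkseq.
  by case/andP => /eqP -> /eqP ->.
by case=> -> ->.
Qed.

Lemma prefix_wordS n w : prefix_word n.+1 w = rcons (prefix_word n w) (letter w n).
Proof. exact: mkseqS. Qed.

Lemma cyl_rcons s a w :
  cyl (rcons s a) w <-> cyl s w /\ letter w (size s) = a.
Proof.
rewrite /cyl /= size_rcons prefix_wordS; split=> [/eqP|[-> ->]//].
by rewrite eqseq_rcons => /andP[/eqP ? /eqP].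
Qed.

Lemma cyl_prefix n w : cyl (prefix_word n w) w.
Proof. by rewrite /cyl /= size_mkseq. Qed.

Lemma cyl_agree s w w' : cyl s w -> cyl s w' ->
  agree (letter w) (letter w') (size s).
Proof. by move=> sw sw'; apply/agree_prefix; rewrite sw sw'. Qed.

(** With [nbhs_agree] below: the words that share a prefix with w form a basis
    of neighbourhoods of w. *)
Lemma near_agree n w : \forall w' \near w, agree (letter w) (letter w') n.
Proof.
apply/nbhs_ballP; exists (expR (- n%:R)) => /=; first exact: expR_gt0.
move=> w'; rewrite ballEmdist /= /mdist /= /half_line_dist /seq_dist.
case: asboolP => [-> _ //|ww']; rewrite ltr_expR ltrN2 ltr_nat => nS j jn.
by apply: (sep_indexP ww').1; rewrite (leq_trans jn)// ltnW.
Qed.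

Lemma nbhs_agree (A : set X) w : nbhs w A ->
  exists n, forall w', agree (letter w) (letter w') n -> A w'.
Proof.
case/nbhs_ballP => e /= e0 eA; exists (Num.truncn (- ln e)).+1 => w' ag.
apply: eA; rewrite ballEmdist /= /mdist /= /half_line_dist /seq_dist.
case: asboolP => // ww'; rewrite -[e]lnK ?posrE// ltr_expR ltrNl.
have := (sep_indexP ww').2 _ ag; rewrite -(ler_nat R); apply: lt_le_trans.
exact: truncnS_gt.
Qed.

Lemma open_agree (A : set X) : (forall w, A w ->
  exists n, forall w', agree (letter w) (letter w') n -> A w') -> open A.
Proof.
move=> H; rewrite openE => w /H[n nA]; rewrite /interior.
by near=> w'; apply: nA; near: w'; exact: near_agree.
Unshelve. all: by end_near. Qed.

Lemma open_cyl s : open (cyl s).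
Proof.
apply: open_agree => w sw; exists (size s) => w' /agree_prefix ag.
by rewrite /cyl /= -ag.
Qed.

Lemma open_measurableX (A : set X) : open A -> measurable A.
Proof. exact: sub_sigma_algebra. Qed.

Lemma measurable_cyl s : measurable (cyl s).
Proof. by apply: open_measurableX; exact: open_cyl. Qed.

Lemma shift_continuous : continuous T.
Proof.
move=> w A /nbhs_agree[n nA]; apply: filterS (near_agree n.+1 w) => w' ag.
by apply: nA => j jn; exact: ag.
Qed.

Lemma iter_shift_continuous n : continuous (iter n T).
Proof.
elim: n => [|n IH] w; first exact: cvg_id.
exact: continuous_comp (IH w) (@shift_continuous (iter n T w)).
Qed.

Lemma measurable_shift n : measurable_fun setT (iter n T).
Proof.
apply: (@measurability _ _ _ _ _ _ (@open X)) => // _ [A oA <-].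
rewrite setTI; apply: open_measurableX; apply: open_comp => // w _.
exact: iter_shift_continuous.
Qed.

Lemma open_gt0 (f : X -> R) : continuous f -> open [set w | 0 < f w].
Proof.
move=> cf; apply: (open_comp (f := f) (D := [set x | 0 < x])) => [w _|].
  exact: cf.
exact: open_gt.
Qed.

Lemma lsc_measurable (f : X -> R) :
  (forall c, open [set w | c < f w]) -> measurable_fun setT f.
Proof.
move=> of_; apply: (measurability _ (RGenOInfty.measurableE R)).
move=> _ [_ [c ->] <-]; rewrite setTI; apply: open_measurableX.
by rewrite preimage_itvoy.
Qed.

End half_line_topology.

(** * Exponential decay of the measure of cylinders *)

Section cylinder_decay.
Context {R : realType} {ell k : nat} {F : {set k.-tuple 'I_ell}}.
Context {F0 : sft_plus F !=set0}.
Local Notation X := (half_line R F0).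
Local Notation T := (@shift_plus R ell k F F0).
Variable mu : probability X R.
Local Notation m A := (fine (mu A)).
Implicit Types (w : X) (s r : seq 'I_ell) (A B : set X).

Lemma fin_prob A : measurable A -> (m A)%:E = mu A.
Proof. by move=> mA; rewrite fineK// fin_num_measure. Qed.

Lemma le_prob A B : measurable A -> measurable B -> A `<=` B -> m A <= m B.
Proof.
by move=> mA mB AB; rewrite -lee_fin !fin_prob// le_measure// inE.
Qed.

Lemma prob_ge0 A : 0 <= m A.
Proof. exact: fine_ge0. Qed.

Lemma prob_le1 A : measurable A -> m A <= 1.
Proof. by move=> mA; rewrite -lee_fin fin_prob// probability_le1. Qed.

Lemma cyl0 : cyl [::] = [set: X].
Proof. by apply/seteqP; split. Qed.

Lemma cyl_catl s r : cyl (s ++ r) `<=` (cyl s : set X).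
Proof. by rewrite cyl_cat => w []. Qed.

Lemma prob_split s A : measurable A ->
  m (A `&` cyl s) = \sum_(a < ell) m (A `&` cyl (rcons s a)).
Proof.
move=> mA; apply: EFin_inj; rewrite fin_prob; last first.
  by apply: measurableI => //; exact: measurable_cyl.
rewrite -sumEFin.
under eq_bigr => a _ do
  rewrite (fin_prob (measurableI _ _ mA (measurable_cyl _))).
rewrite fsbig_seq ?index_enum_uniq// -measure_fin_bigcup//=; first last.
- by move=> a _; apply: measurableI => //; exact: measurable_cyl.
- move=> a b _ _ [w [[_ /cyl_rcons[_ <-]] [_ /cyl_rcons[_ <-]]]] //.
congr (mu _); apply/seteqP; split=> w.
  move=> [Aw sw]; exists (letter w (size s)); first exact: mem_index_enum.
  by split=> //; exact/cyl_rcons.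
by move=> [a _ [Aw /cyl_rcons[sw _]]].
Qed.

Lemma cylinder_cyl n (t : n.+1.-tuple 'I_ell) l :
  cylinder l t = iter l T @^-1` cyl t.
Proof.
apply/seteqP; split=> w; rewrite /cylinder /cyl /= size_tuple.
  move=> H; apply: (@eq_from_nth _ (letter w 0)); rewrite !size_mkseq ?size_tuple//.
  move=> i ni; rewrite nth_mkseq// letter_iter.
  by rewrite (H (Ordinal ni)) (tnth_nth (letter w 0)).
move=> H i; rewrite (tnth_nth (letter w 0)) -H nth_mkseq// letter_iter//.
Qed.

Section invariant.
Hypothesis mu_inv : shift_invariant mu.

Lemma mu_iter_shift n A : measurable A -> mu (iter n T @^-1` A) = mu A.
Proof.
move=> mA; elim: n => [|n IH]; first by congr (mu _).
rewrite -[RHS]IH -[RHS]mu_inv; last first.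
  by rewrite -[X in measurable X]setTI; exact: measurable_shift.
by congr (mu _); apply/seteqP; split=> w; rewrite /preimage /= -iterS iterSr.
Qed.

(** The upper half of bounded distortion, for adjacent words and with the
    position of the second word removed by invariance.  Empty words and empty
    intersections, which the hypothesis leaves out, satisfy it trivially. *)
Lemma prob_cyl_cat : bounded_distortion mu ->
  exists2 gamma : R, 1 <= gamma &
  forall s r, m (cyl (s ++ r)) <= gamma * (m (cyl s) * m (cyl r)).
Proof.
move=> [gamma gamma1 dist]; exists gamma => // s r.
have g0 : 0 < gamma by exact: lt_le_trans ltr01 gamma1.
have [[w sw]|/nonemptyPn ->] := pselect ((cyl (s ++ r) : set X) !=set0); last first.
  by rewrite measure0 /= mulr_ge0 ?mulr_ge0 ?prob_ge0 ?ltW.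
case: s sw => [|a s] sw.
  by rewrite cyl0 probability_setT mul1r ler_peMl ?prob_ge0.
case: r sw => [|b r] sw.
  by rewrite cats0 cyl0 probability_setT mulr1 ler_peMl ?prob_ge0.
have := dist 0 (size s).+1 (size s) (size r) (in_tuple (a :: s)) (in_tuple (b :: r)).
rewrite add0n ltnSn !cylinder_cyl /= => /(_ isT).
have -> : cyl (a :: s) `&` (fun x : X => T (iter (size s) T x)) @^-1` cyl (b :: r) =
  cyl ((a :: s) ++ b :: r) by rewrite cyl_cat.
have mr : m ((fun x : X => T (iter (size s) T x)) @^-1` cyl (b :: r)) = m (cyl (b :: r)).
  by congr fine; apply: (mu_iter_shift (size s).+1); exact: measurable_cyl.
rewrite mr => /(_ (ex_intro _ w sw)) /andP[l1 l2].
set p := m (cyl (a :: s)) * m (cyl (b :: r)) in l1 l2 *.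
have p0 : 0 < p.
  rewrite lt_def mulr_ge0 ?prob_ge0// andbT; apply/eqP => p0.
  by move: l1; rewrite p0 invr0 mulr0 invr_le0 leNgt g0.
by rewrite -ler_pdivrMr.
Qed.

End invariant.

(** Koenig's lemma: otherwise the tree of words whose cylinder has measure at
    least delta is infinite, hence has an infinite branch.  The cylinders along
    it decrease to at most one point, which would have measure at least delta. *)
Lemma nonatomic_prob_cyl (delta : R) : nonatomic mu -> 0 < delta ->
  exists n, forall s, size s = n -> m (cyl s) < delta.
Proof.
move=> na d0; apply: contrapT => /forallNP H.
pose P s := forall n, exists2 r, size r = n & delta <= m (cyl (s ++ r)).
have P0 : P [::].
  move=> n; apply: contrapT => nP; apply: (H n) => s sn.
  by rewrite ltNge; apply/negP => ds; apply: nP; exists s.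
have PS s : P s -> exists a, P (rcons s a).
  move=> Ps; apply: contrapT => /forallNP nP.
  have /choice[N HN] a : exists n, forall r, size r = n ->
      m (cyl (rcons s a ++ r)) < delta.
    apply: contrapT => /forallNP Q; apply: (nP a) => n.
    apply: contrapT => Qn; apply: (Q n) => r rn.
    by rewrite ltNge; apply/negP => ds; apply: Qn; exists r.
  have [[//|a r] [/= rn]] := Ps (\max_a N a).+1.
  rewrite -cat_rcons -[r](cat_take_drop (N a)) catA; apply/negP; rewrite -ltNge.
  apply: le_lt_trans (HN a (take (N a) r) _); last first.
    by rewrite size_takel// rn leq_bigmax.
  apply: le_prob; [exact: measurable_cyl|exact: measurable_cyl|exact: cyl_catl].
(* The branch is chosen letter by letter; off the tree the letter is arbitrary. *)
have /choice[f Pf] s : exists a : 'I_ell, P s -> P (rcons s a).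
  have [/PS[a Pa]|nP] := pselect (P s); first by exists a.
  by exists (letter (point : X) 0).
pose W := fix W n := if n is n'.+1 then rcons (W n') (f (W n')) else [::].
have PW n : P (W n) by elim: n => //= n; exact: Pf.
have sW n : size (W n) = n by elim: n => //= n; rewrite size_rcons => ->.
have mW n : delta <= m (cyl (W n)).
  by have [r /size0nil -> ] := PW n 0%N; rewrite cats0.
have subW : nonincreasing_seq (fun n => cyl (W n) : set X).
  apply/nonincreasing_seqP => n; apply/subsetPset => w /=.
  by move/cyl_rcons => [].
have mI : measurable (\bigcap_n (cyl (W n) : set X)).
  by apply: bigcap_measurable => // n _; exact: measurable_cyl.
have I0 : mu (\bigcap_n cyl (W n)) = 0%E.
  have [[w Ww]|/nonemptyPn ->] := pselect (\bigcap_n (cyl (W n) : set X) !=set0);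
    last by rewrite measure0.
  suff -> : \bigcap_n (cyl (W n)) = [set w] by exact: na.
  apply/seteqP; split=> [w' Ww' /=|_ -> //].
  apply/letter_inj/funext => j.
  have := cyl_agree (Ww' j.+1 I) (Ww j.+1 I); rewrite sW; exact.
have cvgW : mu \o (fun n => cyl (W n)) @ \oo --> 0%E.
  rewrite -I0; apply: nonincreasing_cvg_mu => //.
    by rewrite -ge0_fin_numE// fin_num_measure//; exact: measurable_cyl.
  by move=> i; exact: measurable_cyl.
have : (delta%:E <= limn (mu \o (fun n => cyl (W n))))%E.
  apply: lime_ge; first by apply: cvgP cvgW.
  by apply: nearW => n /=; rewrite -fin_prob ?lee_fin//; exact: measurable_cyl.
by rewrite (cvg_lim _ cvgW)// lee_fin leNgt d0.
Qed.

(** Take n0 for which the gamma-fold measure of a word of length n0 + 1 is at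
    most 1/2; each block of that length then halves the measure, by
    [prob_cyl_cat]. *)
Lemma prob_cyl_decay : shift_invariant mu -> bounded_distortion mu -> nonatomic mu ->
  exists2 kappa : R, 0 < kappa &
  forall s, m (cyl s) <= 2 * expR (- (kappa * (size s)%:R)).
Proof.
move=> inv bdp na; have [gamma gamma1 cat] := prob_cyl_cat inv bdp.
have g0 : 0 < gamma by exact: lt_le_trans ltr01 gamma1.
have [n0 small] : exists n, forall s, size s = n -> m (cyl s) < (2 * gamma)^-1.
  by apply: nonatomic_prob_cyl; rewrite // invr_gt0 mulr_gt0.
have {}small s : size s = n0.+1 -> gamma * m (cyl s) <= 2^-1.
  move=> sn; rewrite -ler_pdivlMl// -invfM mulrC ltW//.
  apply: le_lt_trans (small (take n0 s) _); last by rewrite size_takel// sn.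
  rewrite -{1}(cat_take_drop n0 s).
  apply: le_prob; [exact: measurable_cyl|exact: measurable_cyl|exact: cyl_catl].
have ln2 : 0 < ln 2 :> R by rewrite ln_gt0// ltr1n.
exists (ln 2 / n0.+1%:R) => [|s]; first by rewrite divr_gt0.
have [N] := ubnP (size s); elim: N s => // N IH s; rewrite ltnS => sN.
have [sn|sn] := ltnP (size s) n0.+1.
  rewrite (le_trans (prob_le1 (measurable_cyl _)))// expRN -ler_pdivrMl//.
  rewrite mulr1 lef_pV2 ?posrE ?expR_gt0// -[leRHS]lnK ?posrE// ler_expR.
  by rewrite -mulrA ler_piMr ?(ltW ln2)// mulrC ler_pdivrMr// mul1r ler_nat ltnW.
rewrite -{1}(cat_take_drop n0.+1 s) (le_trans (cat _ _))// mulrA.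
apply: (@le_trans _ _ (2^-1 * m (cyl (drop n0.+1 s)))).
  by rewrite ler_wpM2r ?prob_ge0// small// size_takel.
apply: (@le_trans _ _ (2^-1 *
    (2 * expR (- (ln 2 / n0.+1%:R * (size (drop n0.+1 s))%:R))))).
  by rewrite ler_wpM2l// IH// size_drop; lia.
rewrite mulKf// size_drop natrB// mulrBr divfK// opprB expRD lnK ?posrE//.
Qed.

End cylinder_decay.

(** * Oscillation along a cylinder *)

Section word_sum.
Context {R : realType} {ell : nat}.
Implicit Types (f g : seq 'I_ell -> R) (s : seq 'I_ell).

(** The sum of f over all words of length n, built by appending one letter at a
    time so that it follows the refinement of cylinders. *)
Fixpoint word_sum n f : R :=
  if n is n'.+1 then word_sum n' (fun s => \sum_(a < ell) f (rcons s a))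
  else f [::].

Lemma le_word_sum n f g : (forall s, size s = n -> f s <= g s) ->
  word_sum n f <= word_sum n g.
Proof.
elim: n f g => [|n IH] f g fg /=; first exact: fg.
by apply: IH => s sn; apply: ler_sum => a _; rewrite fg// size_rcons sn.
Qed.

Lemma word_sumD n f g :
  word_sum n (fun s => f s + g s) = word_sum n f + word_sum n g.
Proof.
elim: n f g => //= n IH f g; rewrite -IH; congr word_sum; apply/funext => s.
exact: big_split.
Qed.

Lemma word_sumZ n c f : word_sum n (fun s => c * f s) = c * word_sum n f.
Proof.
elim: n f => //= n IH f; rewrite -IH; congr word_sum; apply/funext => s.
by rewrite mulr_sumr.
Qed.

End word_sum.

Lemma card_le_succ (I : finType) (A B : {set I}) :
  (forall x y, x \in A -> y \in A -> x \notin B -> y \notin B -> x = y) ->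
  (#|A| <= #|B|.+1)%N.
Proof.
move=> AB; rewrite -(cardsID B A) -addn1 leq_add//.
  by apply: subset_leq_card; exact: subsetIr.
apply/card_le1_eqP => x y; rewrite !inE => /andP[xB xA] /andP[yB yA].
by apply: AB.
Qed.

Lemma sep_index_first ell (w w' : nat -> 'I_ell) n :
  agree w w' n -> w n <> w' n -> sep_index w w' = n.
Proof.
move=> ag nn; have ww' : w <> w' by move=> e; apply: nn; rewrite e.
have [a1 m1] := sep_indexP ww'.
apply/eqP; rewrite eqn_leq m1// andbT leqNgt; apply/negP => nS.
exact/nn/a1.
Qed.

Section sturm_on_cylinders.
Context {R : realType} {ell k : nat} {F : {set k.-tuple 'I_ell}}.
Context {F0 : sft_plus F !=set0}.
Local Notation X := (half_line R F0).
Local Notation T := (@shift_plus R ell k F F0).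
Implicit Types (w : X) (s : seq 'I_ell) (A B : set X).
Variables (v : X -> R) (lambda E : R).

Definition site_energy w (j : nat) : R := E - lambda * v (iter j T w).

Definition pot_le n w w' :=
  forall j, (j < n)%N -> v (iter j T w) <= v (iter j T w').

Lemma pot_le_leq n n' w w' : (n <= n')%N -> pot_le n' w w' -> pot_le n w w'.
Proof. by move=> nn' p j jn; apply: p; rewrite (leq_trans jn). Qed.

Lemma dict_lt_iter n w w' j : agree (letter w) (letter w') n ->
  (letter w n < letter w' n)%N -> (j <= n)%N ->
  dict_lt (letter (iter j T w)) (letter (iter j T w')).
Proof.
move=> ag lt_n jn.
have nn : letter (iter j T w) (n - j) <> letter (iter j T w') (n - j).
  rewrite !letter_iter subnKC// => e.
  by move: lt_n; rewrite e ltnn.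
have ag' : agree (letter (iter j T w)) (letter (iter j T w')) (n - j).
  by move=> i; rewrite ltn_subRL !letter_iter => /ag.
split; first by move=> e; apply: nn; rewrite e.
by rewrite (sep_index_first ag' nn) !letter_iter subnKC.
Qed.

Hypothesis v_mono : dict_monotone v.

(** This is where monotonicity enters: if the first difference between w and w'
    is at site n, then T^j w and T^j w' compare in the dictionary order in the
    same way for every j <= n. *)
Lemma pot_le_total n w w' : agree (letter w) (letter w') n ->
  letter w n <> letter w' n -> pot_le n.+1 w w' \/ pot_le n.+1 w' w.
Proof.
wlog lt_n : w w' / (letter w n < letter w' n)%N => [H ag nn|ag _].
  have [|/H|e] := ltngtP (letter w n) (letter w' n); [by move/H; apply| |].
    by case; [exact: agree_sym|exact/nesym|right|left].
  by exfalso; apply: nn; apply/val_inj.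
case: v_mono => vm; [left|right] => j; rewrite ltnS => jn;
  by apply: vm; exact: dict_lt_iter jn.
Qed.

Lemma pot_le_children s (a b : 'I_ell) : a != b ->
  (forall w w', cyl (rcons s a) w -> cyl (rcons s b) w' -> pot_le (size s).+1 w w') \/
  (forall w w', cyl (rcons s a) w -> cyl (rcons s b) w' -> pot_le (size s).+1 w' w).
Proof.
wlog ab : a b / (a < b)%N => [H nab|_].
  have [/H|/H|/val_inj e] := ltngtP a b; first exact.
    by rewrite eq_sym => /(_ nab)[h|h]; [right|left] => w w' ? ?; exact: h.
  by rewrite e eqxx in nab.
case: v_mono => vm; [left|right] => w w' /cyl_rcons[sw wa] /cyl_rcons[sw' wb] j;
  rewrite ltnS => jn; apply: vm; apply: dict_lt_iter jn; rewrite ?wa ?wb//;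
  exact: cyl_agree.
Qed.

(** When no determinant vanishes this is, by Sturm's theorem, the number of
    eigenvalues above E of the operator restricted to the first n sites. *)
Definition sturm_index n w := sign_changes (site_energy w) n.

(** The oscillation of the index on a cylinder, encoded by the set of integers i
    such that the index passes from at most i to more than i.  The sets of
    different children of a cylinder are disjoint, which turns additivity of the
    oscillation into a count of elements.  The bound K only serves to have finite
    sets. *)
Definition index_gaps K n s : {set 'I_K} := [set i : 'I_K | `[< exists w w',
  [/\ cyl s w, cyl s w', nonvanishing (site_energy w) n, nonvanishing (site_energy w') n &
      (sturm_index n w <= i < sturm_index n w')%N] >]].

Definition index_values K n s : {set 'I_K} := [set i : 'I_K | `[< exists w,
  [/\ cyl s w, nonvanishing (site_energy w) n & sturm_index n w = i] >]].

Lemma index_gaps0 K s : index_gaps K 0 s = finset.set0.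
Proof.
apply/setP => i; rewrite !inE; apply/asboolP => -[w [w' [_ _ _ _]]].
by case/andP.
Qed.

(** A value of the index that is not its maximum is a gap. *)
Lemma index_values_gaps K n s : (#|index_values K n s| <= #|index_gaps K n s|.+1)%N.
Proof.
apply: card_le_succ => x y.
wlog xy : x y / (x < y)%N => [H xL yL xG yG|].
  have [|yx|/val_inj//] := ltngtP x y; first by move/H; exact.
  by apply/esym/H.
rewrite !inE => -[w [sw gw wx]] [w' [sw' gw' wy]] /asboolP xG _.
by exfalso; apply: xG; exists w, w'; split=> //; rewrite wx leqnn wy.
Qed.

(** One step adds 0 or 1 to the index, so a new gap can only lie at the maximum
    of the old index. *)
Lemma index_gapsS K n s : (#|index_gaps K n.+1 s| <= #|index_gaps K n s|.+1)%N.
Proof.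
have iS w : (sturm_index n w <= sturm_index n.+1 w <= (sturm_index n w).+1)%N.
  by rewrite /sturm_index /= leq_addr /= -addn1 leq_add// leq_b1.
apply: card_le_succ => x y.
wlog xy : x y / (x < y)%N => [H xL yL xG yG|].
  have [|yx|/val_inj//] := ltngtP x y; first by move/H; exact.
  by apply/esym/H.
rewrite !inE => -[w1 [_ [sw1 _ gw1 _ /andP[w1x _]]]].
move=> [w [w' [sw sw' gw gw' /andP[_ yw']]]] /asboolP xG _.
exfalso; apply: xG; exists w1, w'.
split=> //; [exact: nonvanishingS gw1|exact: nonvanishingS gw'|].
have /andP[iw1 _] := iS w1; have /andP[_ iw'] := iS w'.
by rewrite (leq_trans iw1)//= (leq_trans xy)// -ltnS (leq_trans yw').
Qed.

Hypothesis lambda_gt0 : 0 < lambda.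

Lemma site_energy_le n w w' : pot_le n w w' ->
  forall j, (j < n)%N -> site_energy w' j <= site_energy w j.
Proof. by move=> p j jn; rewrite lerD2l lerN2 ler_pM2l// p. Qed.

Lemma sturm_index_le n w w' : pot_le n w w' -> nonvanishing (site_energy w) n ->
  nonvanishing (site_energy w') n -> (sturm_index n w <= sturm_index n w')%N.
Proof.
move=> /site_energy_le p gw gw'.
by case: (sturm_monotone p gw gw') => [/ltnW//|[]]; rewrite /sturm_index => ->.
Qed.

(** For different letters a and b, the indices on the two children are ordered
    as a whole, so that no i can be a gap for both. *)
Lemma index_gaps_children K s :
  (\sum_(a < ell) #|index_gaps K (size s).+1 (rcons s a)| <=
   #|index_gaps K (size s).+1 s|)%N.
Proof.
under eq_bigr do rewrite -sum1_card.
rewrite -partition_disjoint_bigcup => [|a b ab].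
  rewrite sum1_card subset_leq_card//; apply/bigcupsP => a _.
  apply/fintype.subsetP => i; rewrite !inE => -[w [w' [sw sw' gw gw' ii]]].
  exists w, w'; split=> //.
  - by move: sw => /cyl_rcons[].
  - by move: sw' => /cyl_rcons[].
rewrite -setI_eq0; apply/eqP/setP => i; rewrite !inE; apply/negP => /andP[].
move=> /asboolP[w1 [w1' [sw1 sw1' gw1 gw1' /andP[i1 i1']]]].
move=> /asboolP[w2 [w2' [sw2 sw2' gw2 gw2' /andP[i2 i2']]]].
case: (pot_le_children s ab) => p.
- have := sturm_index_le (p _ _ sw1' sw2) gw1' gw2.
  by move/leq_trans => /(_ _ i2); rewrite leqNgt i1'.
- have := sturm_index_le (p _ _ sw1 sw2') gw2' gw1.
  by move/leq_trans => /(_ _ i1); rewrite leqNgt i2'.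
Qed.

Section small_ratios.
Variables (alpha H : R).
Hypothesis alpha_ge0 : 0 <= alpha.
Hypothesis H_gt0 : 0 < H.
Hypothesis v_anti : forall w w', H * mdist w w' `^ alpha <= `|v w - v w'|.

(** The factor 1/2 leaves room for two points: |t| < radius at both gives
    potentials closer than H e^(- alpha r). *)
Definition ratio_radius (r : nat) : R := lambda * (H / 2 * expR (- (alpha * r%:R))).

Definition small_ratio n r : set X := [set w | nonvanishing (site_energy w) n /\
  `|(sturm (site_energy w) n.+1).1| < ratio_radius r * `|(sturm (site_energy w) n).1| ].

(** For equal indices, both terms of t = E - lambda v(T^n w) + u move in the same
    direction, so that the distance between the two ratios is at least lambda
    times the distance between the two values of v; the anti-Hoelder bound then
    excludes a disagreement before site n + r. *)
Lemma small_ratio_agree n r w w' : small_ratio n r w -> small_ratio n r w' ->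
  sturm_index n w = sturm_index n w' -> agree (letter w) (letter w') n ->
  agree (letter w) (letter w') (n + r).
Proof.
move=> bw bw' ii ag j jnr; apply: contrapT => jj.
have exd : exists j, letter w j != letter w' j by exists j; exact/eqP.
case: (ex_minnP exd) => S /eqP Sd Smin.
have agS : agree (letter w) (letter w') S.
  by move=> i iS; apply/eqP; apply: contraTT iS => /Smin; rewrite -leqNgt.
have nS : (n <= S)%N by rewrite leqNgt; apply/negP => /ag.
have Sr : (S < n + r)%N by apply: leq_ltn_trans jnr; apply: Smin; exact/eqP.
wlog : w w' bw bw' ii Sd agS {exd Smin ag jj} / pot_le S.+1 w w' => [W|p].
  case: (pot_le_total agS Sd) => p; first exact: (W w w').
  by apply: (W w' w) => //; [exact: nesym|exact: agree_sym].
move: bw bw' => [gw bw] [gw' bw'].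
have ratio x : nonvanishing (site_energy x) n -> `|(sturm (site_energy x) n.+1).1| <
    ratio_radius r * `|(sturm (site_energy x) n).1| ->
    `|site_energy x n + riccati (site_energy x) n| < ratio_radius r.
  move=> gx; rewrite -sturm_ratio// normrM normfV ltr_pdivrMr//.
  by rewrite normr_gt0 gx.
have {}bw := ratio _ gw bw; have {}bw' := ratio _ gw' bw'.
have := sturm_monotone (site_energy_le (pot_le_leq (leqW nS) p)) gw gw'.
case; rewrite -/(sturm_index n w) -/(sturm_index n w') ii ?ltnn// => -[_ uu].
have := p n nS; rewrite -subr_ge0 => vv.
have lv : lambda * (v (iter n T w') - v (iter n T w)) < 2 * ratio_radius r.
  rewrite mulr_natl mulr2n; apply: le_lt_trans (ltrD bw bw').
  apply: le_trans (ler_normB _ _); rewrite ler_normr; apply/orP; left.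
  rewrite /site_energy mulrBr.
  by move: uu; set a := riccati _ _; set b := riccati _ _ => uu; lra.
have := v_anti (iter n T w') (iter n T w).
rewrite ger0_norm// leNgt => /negP; apply.
rewrite -(ltr_pM2l lambda_gt0) (lt_le_trans lv)//.
rewrite /ratio_radius mulrCA ler_pM2l// mulrA mulrC.
have -> : 2 * (H / 2) = H by field.
rewrite mulrC ler_pM2l//.
have nn : letter (iter n T w) (S - n) <> letter (iter n T w') (S - n).
  by rewrite !letter_iter subnKC.
have agn : agree (letter (iter n T w)) (letter (iter n T w')) (S - n).
  by move=> i; rewrite ltn_subRL !letter_iter => /agS.
rewrite /mdist /= /half_line_dist /seq_dist asboolF; last first.
  by move=> e; apply: nn; rewrite e.
rewrite sep_index_sym (sep_index_first agn nn) -expRM ler_expR mulNr lerN2 mulrC.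
by rewrite ler_wpM2l// ler_nat; lia.
Qed.

End small_ratios.
End sturm_on_cylinders.

(** * Small ratios are rare *)

Section wegner.
Context {R : realType} {ell k : nat} {F : {set k.-tuple 'I_ell}}.
Context {F0 : sft_plus F !=set0}.
Local Notation X := (half_line R F0).
Local Notation T := (@shift_plus R ell k F F0).
Variable mu : probability X R.
Local Notation m A := (fine (mu A)).
Implicit Types (w : X) (s : seq 'I_ell) (A B : set X).

Lemma word_sum_prob n A : measurable A ->
  word_sum n (fun s => m (A `&` cyl s)) = m A.
Proof.
move=> mA; elim: n => [|n IH]; first by rewrite /= cyl0 setIT.
rewrite -[RHS]IH /=; congr word_sum; apply/funext => s.
by rewrite -prob_split.
Qed.

Lemma word_sum_cyl n : word_sum n (fun s => m (cyl s)) = 1.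
Proof.
rewrite -(_ : m [set: X] = 1); last by rewrite probability_setT.
rewrite -(word_sum_prob n measurableT); congr word_sum; apply/funext => s.
by rewrite setTI.
Qed.

Lemma prob_bigsetU (I : Type) (l : seq I) (P : pred I) (B : I -> set X) :
  (forall i, measurable (B i)) ->
  m (\big[setU/set0]_(i <- l | P i) B i) <= \sum_(i <- l | P i) m (B i).
Proof.
move=> mB; elim: l => [|i l IH]; first by rewrite !big_nil measure0.
rewrite !big_cons; case: ifP => // _.
have mU : measurable (\big[setU/set0]_(j <- l | P j) B j).
  by apply: bigsetU_measurable.
apply: le_trans (lerD (lexx _) IH).
rewrite -lee_fin EFinD !fin_prob//; last exact: measurableU.
exact: measureU2.
Qed.

Variables (gamma kappa : R).
Hypothesis gamma_ge1 : 1 <= gamma.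
Hypothesis kappa_gt0 : 0 < kappa.
Hypothesis cyl_cat : forall s r,
  m (cyl (s ++ r)) <= gamma * (m (cyl s) * m (cyl r)).
Hypothesis cyl_decay : forall s,
  m (cyl s) <= 2 * expR (- (kappa * (size s)%:R)).

Let gamma_gt0 : 0 < gamma. Proof. exact: lt_le_trans ltr01 gamma_ge1. Qed.

Lemma prob_cyl_ext s r :
  m (cyl (s ++ r)) <= 2 * gamma * m (cyl s) * expR (- (kappa * (size r)%:R)).
Proof.
apply: (le_trans (cyl_cat s r)).
have -> : 2 * gamma * m (cyl s) * expR (- (kappa * (size r)%:R)) =
  gamma * (m (cyl s) * (2 * expR (- (kappa * (size r)%:R)))) by ring.
by rewrite !ler_wpM2l ?prob_ge0 ?(ltW gamma_gt0).
Qed.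

(** A substitute for mu(cyl s), equal to it up to a constant factor, that
    contracts by e^(- kappa) or more with each letter, as in
    [cyl_weight_rcons].  For mu itself the contraction only shows after several
    letters, since a cylinder may have a single child. *)
Definition cyl_weight s : R :=
  sup (range (fun r => m (cyl (s ++ r)) * expR (kappa * (size r)%:R))).

Let weight_ub s : ubound
  (range (fun r => m (cyl (s ++ r)) * expR (kappa * (size r)%:R)))
  (2 * gamma * m (cyl s)).
Proof.
move=> _ [r _ <-]; rewrite -ler_pdivlMr ?expR_gt0// -expRN.
exact: prob_cyl_ext.
Qed.

Lemma cyl_weight_ge s r :
  m (cyl (s ++ r)) * expR (kappa * (size r)%:R) <= cyl_weight s.
Proof. by apply: ub_le_sup; [exists (2 * gamma * m (cyl s))|exists r]. Qed.

Lemma prob_cyl_le_weight s : m (cyl s) <= cyl_weight s.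
Proof. by have := cyl_weight_ge s [::]; rewrite cats0 mulr0 expR0 mulr1. Qed.

Lemma cyl_weight_le s : cyl_weight s <= 2 * gamma * m (cyl s).
Proof. by apply: ge_sup => //; exact: (image_nonempty _ (ex_intro _ [::] I)). Qed.

Lemma cyl_weight_ge0 s : 0 <= cyl_weight s.
Proof. exact: le_trans (prob_ge0 _ _) (prob_cyl_le_weight s). Qed.

Lemma cyl_weight_rcons s a :
  cyl_weight (rcons s a) <= expR (- kappa) * cyl_weight s.
Proof.
apply: ge_sup; first exact: (image_nonempty _ (ex_intro _ [::] I)).
move=> _ [r _ <-]; rewrite mulrC expRN ler_pdivlMl ?expR_gt0// mulrA -expRD.
have -> : kappa + kappa * (size r)%:R = kappa * (size (a :: r))%:R.
  by rewrite /= -[in RHS]natr1 mulrDr mulr1 addrC.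
by rewrite cat_rcons mulrC cyl_weight_ge.
Qed.

Variables (v : X -> R) (lambda E : R).
Hypothesis v_mono : dict_monotone v.
Hypothesis lambda_gt0 : 0 < lambda.
Local Notation index_gaps := (index_gaps v lambda E).
Local Notation index_values := (index_values v lambda E).
Local Notation site_energy := (site_energy v lambda E).
Local Notation sturm_index := (sturm_index v lambda E).

(** The fixed point of the recursion Y = e^(- kappa) Y + 2 gamma, which
    dominates the one satisfied by the weighted oscillations. *)
Definition gap_bound : R := 2 * gamma / (1 - expR (- kappa)).

Let q_lt1 : expR (- kappa) < 1.
Proof. by rewrite -expR0 ltr_expR oppr_lt0. Qed.

Let q_gt0 : 0 < 1 - expR (- kappa).
Proof. by rewrite subr_gt0. Qed.

Lemma gap_bound_ge0 : 0 <= gap_bound.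
Proof. by rewrite divr_ge0 ?mulr_ge0 ?ltW. Qed.

(** Passing to the children multiplies the weight by e^(- kappa) while the total
    oscillation of the children exceeds that of the parent by at most one. *)
Lemma weighted_index_gaps K n :
  word_sum n (fun s => cyl_weight s * #|index_gaps K n s|%:R) <= gap_bound.
Proof.
elim: n => [|n IH]; first by rewrite /= index_gaps0 cards0 mulr0 gap_bound_ge0.
apply: (@le_trans _ _ (word_sum n (fun s => expR (- kappa) *
    (cyl_weight s * #|index_gaps K n s|%:R + 2 * gamma * m (cyl s))))).
  rewrite [leLHS]/=; apply: le_word_sum => s sn.
  apply: (@le_trans _ _ (\sum_(a < ell) expR (- kappa) * cyl_weight s *
      #|index_gaps K n.+1 (rcons s a)|%:R)).
    by apply: ler_sum => a _; rewrite ler_wpM2r// cyl_weight_rcons.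
  rewrite -mulr_sumr -natr_sum -mulrA ler_wpM2l ?expR_ge0//.
  have gc : (\sum_(a < ell) #|index_gaps K n.+1 (rcons s a)| <= #|index_gaps K n s|.+1)%N.
    rewrite (leq_trans _ (index_gapsS _ _ _ _ _ _))// -sn.
    exact: index_gaps_children.
  apply: (@le_trans _ _ (cyl_weight s * #|index_gaps K n s|.+1%:R)).
    by rewrite ler_wpM2l ?cyl_weight_ge0// ler_nat.
  by rewrite -natr1 mulrDr mulr1 lerD2l cyl_weight_le.
rewrite word_sumZ word_sumD word_sumZ word_sum_cyl mulr1.
apply: (@le_trans _ _ (expR (- kappa) * (gap_bound + 2 * gamma))).
  by rewrite ler_wpM2l ?expR_ge0// lerD2r.
have e : gap_bound * (1 - expR (- kappa)) = 2 * gamma.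
  by rewrite divfK// gt_eqF.
rewrite mulrDr mulrC -lerBrDl -{1}[gap_bound]mulr1 -mulrBr e.
by rewrite ler_piMl ?(ltW q_lt1)// mulr_ge0 ?ltW.
Qed.

Lemma mean_index_gaps K n :
  word_sum n (fun s => m (cyl s) * #|index_gaps K n s|.+1%:R) <= gap_bound + 1.
Proof.
rewrite -[X in _ <= _ + X](word_sum_cyl n).
apply: le_trans (lerD (weighted_index_gaps K n) (lexx _)).
rewrite -word_sumD; apply: le_word_sum => s _.
by rewrite -natr1 mulrDr mulr1 lerD2r ler_wpM2r// prob_cyl_le_weight.
Qed.

Variables (alpha H : R).
Hypothesis alpha_gt0 : 0 < alpha.
Hypothesis H_gt0 : 0 < H.
Hypothesis v_anti : forall w w', H * mdist w w' `^ alpha <= `|v w - v w'|.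
Hypothesis v_cont : continuous v.
Local Notation small_ratio := (small_ratio v lambda E alpha H).

Lemma sturm_continuous n :
  continuous (fun w => (sturm (site_energy w) n).1) /\
  continuous (fun w => (sturm (site_energy w) n).2).
Proof.
elim: n => [|n [IH1 IH2]]; first by split; exact: cst_continuous.
split=> //= w.
have vc : {for w, continuous (v \o iter n T)}.
  exact: continuous_comp (@iter_shift_continuous _ _ _ _ _ n w) (@v_cont (iter n T w)).
have sc : {for w, continuous (fun w => site_energy w n)}.
  by apply: continuousB; [exact: cst_continuous|
     apply: continuousM; [exact: cst_continuous|exact: vc]].
exact: continuousB (continuousM sc (IH1 w)) (IH2 w).
Qed.

Lemma measurable_nonvanishing n : measurable [set w | nonvanishing (site_energy w) n].
Proof.
have P n' : measurable [set w | (sturm (site_energy w) n').1 != 0].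
  apply: open_measurableX.
  rewrite (_ : [set _ | _] = [set w | 0 < `|(sturm (site_energy w) n').1|]).
    apply: open_gt0 => w.
    exact: continuous_comp ((sturm_continuous n').1 w) (@norm_continuous _ _ _).
  by apply/seteqP; split=> w /=; rewrite normr_gt0.
elim: n => [|n IH].
  rewrite (_ : [set _ | _] = setT) //; apply/seteqP; split=> // w _ j.
  by rewrite leqn0 => /eqP ->; rewrite oner_eq0.
rewrite (_ : [set _ | _] = [set w | nonvanishing (site_energy w) n] `&`
  [set w | (sturm (site_energy w) n.+1).1 != 0]); first exact: measurableI.
apply/seteqP; split=> w /=.
  by move=> g; split; [exact: nonvanishingS|exact: (g n.+1 (leqnn _))].
by move=> [g g'] j; rewrite leq_eqVlt => /predU1P[->|/g].
Qed.

Lemma measurable_small_ratio n r : measurable (small_ratio n r).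
Proof.
rewrite (_ : small_ratio n r = [set w | nonvanishing (site_energy w) n] `&` [set w |
  0 < ratio_radius lambda alpha H r * `|(sturm (site_energy w) n).1| -
      `|(sturm (site_energy w) n.+1).1| ]).
  apply: measurableI; first exact: measurable_nonvanishing.
  apply: open_measurableX; apply: open_gt0 => w.
  have sn n' : {for w, continuous (fun w => `|(sturm (site_energy w) n').1|)}.
    exact: continuous_comp ((sturm_continuous n').1 w) (@norm_continuous _ _ _).
  apply: continuousB (sn n.+1).
  by apply: continuousM (sn n); exact: cst_continuous.
by apply/seteqP; split=> w; rewrite /= subr_gt0.
Qed.

(** One cylinder of r further letters for each value of the index. *)
Lemma prob_small_ratio_cyl n r s : size s = n ->
  m (small_ratio n r `&` cyl s) <=
  2 * gamma * expR (- (kappa * r%:R)) * (m (cyl s) * #|index_gaps n.+1 n s|.+1%:R).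
Proof.
move=> sn; set L := index_values n.+1 n s.
(* rho i is the continuation of s shared by the points with index i. *)
have /choice[rho Hrho] (i : 'I_n.+1) : exists rho : seq 'I_ell, size rho = r /\
    (forall w, small_ratio n r w -> cyl s w -> sturm_index n w = i -> cyl (s ++ rho) w).
  have [[w [bw sw wi]]|nw] :=
      pselect (exists w, [/\ small_ratio n r w, cyl s w & sturm_index n w = i]).
    exists (prefix_word r (iter n T w)); split; first by rewrite size_mkseq.
    move=> w' bw' sw' w'i.
    have := small_ratio_agree v_mono lambda_gt0 (ltW alpha_gt0) H_gt0 v_anti bw bw'.
    rewrite wi w'i => /(_ erefl).
    rewrite -sn => /(_ (cyl_agree sw sw')) /agree_prefix ag.
    rewrite -[s in cyl (s ++ _)]sw -prefix_wordD ag.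
    exact: cyl_prefix.
  have [rho rhor] : exists rho : seq 'I_ell, size rho = r.
    by exists (prefix_word r (point : X)); rewrite size_mkseq.
  exists rho; split=> // w bw sw wi; exfalso; apply: nw.
  by exists w.
apply: (@le_trans _ _ (m (\big[setU/set0]_(i in L) cyl (s ++ rho i)))).
  apply: le_prob.
  - by apply: measurableI; [exact: measurable_small_ratio|exact: measurable_cyl].
  - by apply: bigsetU_measurable => i _; exact: measurable_cyl.
  move=> w [bw sw].
  have iw : (sturm_index n w < n.+1)%N by rewrite ltnS sign_changes_leq.
  rewrite -bigcup_seq_cond; exists (Ordinal iw); last exact: (Hrho _).2.
  rewrite /= mem_index_enum inE /=; apply/asboolP.
  by exists w; split=> //; exact: bw.1.
apply: (le_trans (prob_bigsetU _ _ _)) => [i|]; first exact: measurable_cyl.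
apply: (@le_trans _ _ (\sum_(i in L)
    2 * gamma * m (cyl s) * expR (- (kappa * r%:R)))).
  apply: ler_sum => i _; apply: le_trans (prob_cyl_ext _ _) _.
  by rewrite (Hrho i).1.
rewrite sumr_const -[leLHS]mulr_natr.
have -> : 2 * gamma * expR (- (kappa * r%:R)) * (m (cyl s) * #|index_gaps n.+1 n s|.+1%:R)
  = 2 * gamma * m (cyl s) * expR (- (kappa * r%:R)) * #|index_gaps n.+1 n s|.+1%:R.
  by ring.
rewrite ler_wpM2l ?ler_nat ?index_values_gaps//.
by rewrite !mulr_ge0 ?prob_ge0 ?expR_ge0 ?ltW.
Qed.

(** A Wegner estimate: up to constants that only depend on mu, the probability
    that the determinant drops by the factor [ratio_radius] decays with r. *)
Lemma prob_small_ratio n r : m (small_ratio n r) <=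
  2 * gamma * (gap_bound + 1) * expR (- (kappa * r%:R)).
Proof.
rewrite -(word_sum_prob n (measurable_small_ratio n r)).
apply: le_trans (le_word_sum (fun s => @prob_small_ratio_cyl n r s)) _.
rewrite word_sumZ [leRHS]mulrAC.
by rewrite ler_wpM2l ?mean_index_gaps// !mulr_ge0 ?expR_ge0 ?(ltW gamma_gt0).
Qed.

End wegner.

(** * The cocycle *)

Section lyapunov.
Context {R : realType} {ell k : nat} {F : {set k.-tuple 'I_ell}}.
Context {F0 : sft_plus F !=set0}.
Local Notation X := (half_line R F0).
Local Notation T := (@shift_plus R ell k F F0).
Implicit Types (w : X).
Variables (v : X -> R) (lambda E : R).
Local Notation A := (cocycle v lambda E).
Local Notation site_energy := (site_energy v lambda E).

Lemma cocycleS_row0 n w j : A n.+1 w 0 j = site_energy w n * A n w 0 j - A n w 1 j.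
Proof.
rewrite /= mxE !big_ord_recl big_ord0 !mxE /= addr0 mulN1r.
by rewrite (_ : lift ord0 ord0 = 1 :> 'I_2)//; exact: val_inj.
Qed.

Lemma cocycleS_row1 n w j : A n.+1 w 1 j = A n w 0 j.
Proof. by rewrite /= mxE !big_ord_recl big_ord0 !mxE /= mul1r mul0r !addr0. Qed.

Lemma cocycle_col0 n w :
  A n w 0 0 = (sturm (site_energy w) n).1 /\
  A n w 1 0 = (sturm (site_energy w) n).2.
Proof.
elim: n => [|n [IH1 IH2]]; first by rewrite /= !mxE.
by rewrite cocycleS_row0 cocycleS_row1 IH1 IH2.
Qed.

Lemma det_cocycle n w : \det (A n w) = 1.
Proof.
elim: n => [|n IH]; first exact: det1.
rewrite /= det_mulmx IH mulr1.
rewrite (expand_det_row _ 0) !big_ord_recl big_ord0 /cofactor !det_mx11 !mxE /=.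
by ring.
Qed.

Lemma cocycleD n n' w : A (n + n') w = A n (iter n' T w) *m A n' w.
Proof.
elim: n => [|n IH]; first by rewrite add0n /= mul1mx.
by rewrite addSn /= IH mulmxA -iterD.
Qed.

Definition log_growth n w : R := ln (operator_norm (A n w)).

Lemma cocycle_ge1 n w : 1 <= operator_norm (A n w).
Proof. by apply: opnorm_ge1; exact: det_cocycle. Qed.

Lemma log_growth_ge0 n w : 0 <= log_growth n w.
Proof. by rewrite /log_growth ln_ge0// cocycle_ge1. Qed.

Lemma log_growthD n n' w :
  log_growth (n + n') w <= log_growth n (iter n' T w) + log_growth n' w.
Proof.
have p i x : 0 < operator_norm (A i x) by rewrite (lt_le_trans ltr01)// cocycle_ge1.
rewrite /log_growth cocycleD -lnM ?posrE// ler_ln ?posrE ?mulr_gt0//.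
  exact: opnormM.
by rewrite -cocycleD.
Qed.

Lemma ln_sturm_le n w : (sturm (site_energy w) n).1 != 0 ->
  ln `|(sturm (site_energy w) n).1| <= log_growth n w.
Proof.
move=> P0; rewrite /log_growth ler_ln ?posrE ?normr_gt0//.
  by rewrite -(cocycle_col0 n w).1 ler_entry_opnorm.
by rewrite (lt_le_trans ltr01)// cocycle_ge1.
Qed.

Hypothesis v_bounded : bounded_fun v.

Lemma log_growth_bounded : exists2 M : R, 0 <= M &
  forall n w, log_growth n w <= n%:R * M.
Proof.
have [M0 [_ /(_ (M0 + 1))]] := v_bounded; rewrite ltrDl ltr01 => /(_ isT) vM.
pose M := `|E| + `|lambda| * (M0 + 1) + 2.
have nM w : operator_norm (A 1 w) <= M.
  apply: le_trans (opnorm_le_sum _) _; rewrite /= mulmx1.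
  rewrite !big_ord_recl !big_ord0 !mxE /= normrN normr0 normr1 !addr0.
  rewrite /M; have -> : 2 = 1 + 1 :> R by [].
  rewrite addrA lerD2r lerD2r (le_trans (ler_normB _ _))// lerD2l normrM.
  by rewrite ler_wpM2l// vM.
have M1 : 1 <= M := le_trans (cocycle_ge1 1 point) (nM point).
exists (ln M); first exact: ln_ge0.
elim=> [|n IH] w.
  rewrite mul0r /log_growth /=.
  have -> : operator_norm (1%:M : 'M[R]_2) = 1; last by rewrite ln1.
  apply/eqP; rewrite eq_le (cocycle_ge1 0 w) andbT.
  apply: ge_sup => [|_ [x /= x1 <-]]; last by rewrite mul1mx x1.
  by case: (has_sup_opnorm (1%:M : 'M[R]_2)).
rewrite -addn1 addnC natrD mulrDl mul1r (le_trans (log_growthD _ _ _))// lerD//.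
rewrite /log_growth ler_ln ?posrE ?(lt_le_trans ltr01)//.
exact: cocycle_ge1.
Qed.

Hypothesis v_cont : continuous v.

Lemma cocycle_continuous n i j : continuous (fun w => A n w i j).
Proof.
elim: n i j => [|n IH] i j w; first exact: cst_continuous.
have [->|->] : i = 0 \/ i = 1.
- by case: i => -[|[|//]] ?; [left|right]; exact: val_inj.
- under eq_fun do rewrite cocycleS_row0.
  have vc : {for w, continuous (v \o iter n T)}.
    exact: continuous_comp (@iter_shift_continuous _ _ _ _ _ n w) (@v_cont (iter n T w)).
  apply: continuousB (IH 1 j w); apply: continuousM (IH 0 j w).
  apply: continuousB; first exact: cst_continuous.
  by apply: continuousM; [exact: cst_continuous|exact: vc].
- by under eq_fun do rewrite cocycleS_row1; exact: IH.
Qed.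

Lemma measurable_log_growth n : measurable_fun setT (log_growth n).
Proof.
apply: measurableT_comp; first exact: measurable_ln.
apply: lsc_measurable => c.
rewrite (_ : [set _ | _] = \bigcup_(x in [set x : 'cV[R]_2 | euclidean_norm x = 1])
   [set w | 0 < euclidean_norm (A n w *m x) - c]); last first.
  apply/seteqP; split=> w /=.
    by move=> /lt_opnorm[x x1 cx]; exists x => //=; rewrite subr_gt0.
  by move=> [x /= x1]; rewrite subr_gt0 => cx; apply/lt_opnorm; exists x.
apply: bigcup_open => x _; apply: open_gt0 => w.
have cA i : continuous (fun w => (A n w *m x) i 0).
  move=> w0; under eq_fun do rewrite !mxE !big_ord_recl !big_ord0 addr0.
  have c2 j : {for w0, continuous (fun w => A n w i j * x j 0)}.
    by apply: continuousM; [exact: cocycle_continuous|exact: cst_continuous].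
  exact: continuousD (c2 _) (c2 _).
have cS : continuous (fun w => \sum_i (A n w *m x) i 0 ^+ 2).
  move=> w0; under eq_fun do rewrite !big_ord_recl big_ord0 addr0.
  have c2 i : {for w0, continuous (fun w => (A n w *m x) i 0 ^+ 2)}.
    by apply: continuousM; exact: cA.
  exact: continuousD (c2 _) (c2 _).
have cN : continuous (fun w => euclidean_norm (A n w *m x)).
  move=> w0; exact: continuous_comp (cS w0) (@sqrt_continuous _ _).
exact: continuousB (cN w) (@cst_continuous _ _ c w).
Qed.

End lyapunov.

(** * A pointwise lower bound for the growth *)

Section lower_bound.
Context {R : realType} {ell k : nat} {F : {set k.-tuple 'I_ell}}.
Context {F0 : sft_plus F !=set0}.
Local Notation X := (half_line R F0).
Local Notation T := (@shift_plus R ell k F F0).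
Implicit Types (w : X).
Variables (v : X -> R) (lambda E alpha H : R).
Hypothesis lambda_gt0 : 0 < lambda.
Hypothesis alpha_gt0 : 0 < alpha.
Hypothesis H_gt0 : 0 < H.
Local Notation site_energy := (site_energy v lambda E).
Local Notation P n w := (sturm (site_energy w) n).1.
Local Notation small_ratio := (small_ratio v lambda E alpha H).
Local Notation log_growth := (log_growth v lambda E).

(** The number of scales r at which the ratio at site n is small.  It is infinite
    when the ratio vanishes, so that the bounds below hold at every w and no
    exceptional set is needed. *)
Definition small_ratio_count n w : \bar R := (\sum_(r <oo) (\1_(small_ratio n r) w)%:E)%E.

Lemma small_ratio_count_ge N n w : (forall r, (r < N)%N -> small_ratio n r w) ->
  (N%:R%:E <= small_ratio_count n w)%E.
Proof.
move=> bN; apply: le_trans (nneseries_lim_ge N _); last first.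
  by move=> r _ _; rewrite lee_fin.
rewrite big_nat (eq_bigr (fun=> 1%:E)); last first.
  by move=> r /andP[_ rN]; rewrite indicE mem_set//; exact: bN.
by rewrite -big_nat sumEFin big_const_nat iter_addr_0 subn0.
Qed.

Lemma small_ratio_count_ge0 n w : (0 <= small_ratio_count n w)%E.
Proof. by have := @small_ratio_count_ge 0 n w; apply. Qed.

Lemma small_ratio_count_pinfty n w : nonvanishing (site_energy w) n -> P n.+1 w = 0 ->
  small_ratio_count n w = +oo%E.
Proof.
move=> gw P0; apply/eqyP => A A0.
apply: le_trans (@small_ratio_count_ge (Num.truncn A).+1 n w _).
  by rewrite lee_fin ltW// truncnS_gt.
move=> r _; split=> //; rewrite P0 normr0 mulr_gt0 ?normr_gt0 ?(gw n)//.
by rewrite !mulr_gt0 ?invr_gt0 ?expR_gt0.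
Qed.

(** If N is the first scale that the ratio attains, the ratio is at least
    lambda (H/2) e^(- alpha N) and the scales below N are all counted. *)
Lemma log_ratio_ge n w : nonvanishing (site_energy w) n.+1 ->
  ((ln (lambda * (H / 2)))%:E <=
   (ln `|P n.+1 w| - ln `|P n w|)%:E + alpha%:E * small_ratio_count n w)%E.
Proof.
move=> gw; have c0 : 0 < lambda * (H / 2) by rewrite !mulr_gt0 ?invr_gt0.
have p0 : 0 < `|P n w| by rewrite normr_gt0 gw.
have p1 : 0 < `|P n.+1 w| by rewrite normr_gt0 gw.
pose attained N := ratio_radius lambda alpha H N * `|P n w| <= `|P n.+1 w|.
have lnr N : ln (ratio_radius lambda alpha H N * `|P n w|) =
    ln (lambda * (H / 2)) - alpha * N%:R + ln `|P n w|.
  rewrite /ratio_radius mulrA !lnM ?posrE ?mulr_gt0 ?invr_gt0 ?expR_gt0//.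
  by rewrite expRK.
have exN : exists N, attained N.
  exists (Num.truncn ((ln (lambda * (H / 2)) + ln `|P n w| - ln `|P n.+1 w|) / alpha)).+1.
  rewrite /attained -ler_ln ?posrE// ?lnr; last first.
    by rewrite !mulr_gt0 ?invr_gt0 ?expR_gt0.
  have := truncnS_gt ((ln (lambda * (H / 2)) + ln `|P n w| - ln `|P n.+1 w|) / alpha).
  rewrite ltr_pdivrMr//; lra.
case: (ex_minnP exN) => N gN minN.
have bN r : (r < N)%N -> small_ratio n r w.
  move=> rN; split; first exact: nonvanishingS.
  by rewrite ltNge; apply/negP => /minN; rewrite leqNgt rN.
apply: le_trans (leeD2l _ (lee_wpmul2l _ (small_ratio_count_ge bN))); last first.
  by rewrite lee_fin ltW.
rewrite -EFinM -EFinD lee_fin.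
move: gN; rewrite /attained -ler_ln ?posrE// ?lnr; last first.
  by rewrite !mulr_gt0 ?invr_gt0 ?expR_gt0.
lra.
Qed.

(** Sum of [log_ratio_ge] over the sites when no determinant vanishes; otherwise
    the count at the first vanishing one is infinite. *)
Lemma log_growth_ge n w : ((n%:R * ln (lambda * (H / 2)))%:E <=
  (log_growth n w)%:E + \sum_(i < n) (alpha%:E * small_ratio_count i w))%E.
Proof.
have aS0 i : (0 <= alpha%:E * small_ratio_count i w)%E.
  by rewrite mule_ge0 ?small_ratio_count_ge0// lee_fin ltW.
have [gw|[j jn [gw Pj]]] : nonvanishing (site_energy w) n \/
    exists2 j, (j < n)%N & nonvanishing (site_energy w) j /\ P j.+1 w = 0.
- elim: n => [|n [gw|[j jn gw]]].
  + by left=> j; rewrite leqn0 => /eqP ->; rewrite oner_eq0.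
  + have [P0|P0] := eqVneq (P n.+1 w) 0; first by right; exists n.
    by left=> j; rewrite leq_eqVlt => /predU1P[->//|/gw].
  + by right; exists j => //; exact: ltnW.
- apply: (@le_trans _ _ ((ln `|P n w|)%:E +
      \sum_(i < n) (alpha%:E * small_ratio_count i w))%E); last first.
    by rewrite leeD2r// lee_fin ln_sturm_le// gw.
  elim: n gw => [|n IH] gw.
    by rewrite mul0r big_ord0 normr1 ln1 adde0.
  rewrite big_ord_recr /= -natr1 mulrDl mul1r EFinD.
  apply: le_trans (leeD (IH (nonvanishingS gw)) (log_ratio_ge gw)) _.
  by rewrite addeACA -EFinD subrKC.
- have aj : (alpha%:E * small_ratio_count j w = +oo)%E.
    by rewrite (small_ratio_count_pinfty gw Pj) gt0_muley// lte_fin.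
  rewrite (bigD1 (Ordinal jn))//= aj.
  have s0 : (\sum_(i < n | i != Ordinal jn) (alpha%:E * small_ratio_count i w) != -oo)%E.
    by rewrite gt_eqF// (lt_le_trans (ltNyr 0))// sume_ge0.
  by rewrite addye// addey// leey.
Qed.

End lower_bound.

(** * The mean growth and the Lyapunov exponent *)

Section mean_growth.
Context {R : realType} {ell k : nat} {F : {set k.-tuple 'I_ell}}.
Context {F0 : sft_plus F !=set0}.
Local Notation X := (half_line R F0).
Local Notation T := (@shift_plus R ell k F F0).
Variable mu : probability X R.
Variables (v : X -> R) (lambda E : R).
Hypothesis mu_inv : shift_invariant mu.
Hypothesis v_bounded : bounded_fun v.
Hypothesis v_cont : continuous v.
Local Notation log_growth := (log_growth v lambda E).

Definition mean_growth n : R := \int[mu]_(w in setT) log_growth n w.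

Lemma mean_growth_ge0 n : 0 <= mean_growth n.
Proof. by apply: Rintegral_ge0 => w _; exact: log_growth_ge0. Qed.

Lemma integrable_log_growth n : mu.-integrable setT (EFin \o log_growth n).
Proof.
have [M M0 HM] := log_growth_bounded lambda E v_bounded.
apply: measurable_bounded_integrable => //.
- by rewrite -ge0_fin_numE// fin_num_measure.
- exact: measurable_log_growth.
- exists (n%:R * M); split; first exact: num_real.
  move=> x nMx w _ /=; rewrite ger0_norm ?log_growth_ge0//.
  by rewrite (le_trans (HM _ _))// ltW.
Qed.

Lemma mean_growthE n : (mean_growth n)%:E = (\int[mu]_w (log_growth n w)%:E)%E.
Proof.
rewrite /mean_growth /Rintegral fineK//.
by apply: integrable_fin_num => //; exact: integrable_log_growth.
Qed.

Lemma integral_log_growth_iter n n' :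
  (\int[mu]_w (log_growth n (iter n' T w))%:E = \int[mu]_w (log_growth n w)%:E)%E.
Proof.
have mf : measurable_fun setT (EFin \o log_growth n).
  by apply/measurable_EFinP; exact: measurable_log_growth.
have := @ge0_integral_pushforward _ _ _ _ _ _ (@measurable_shift _ _ _ _ F0 n') mu setT
  (EFin \o log_growth n) measurableT mf.
rewrite preimage_setT => <-; last first.
  by move=> w _; rewrite lee_fin log_growth_ge0.
apply: eq_measure_integral => [|mT A mA _]; first exact: measurable_shift.
exact: (mu_iter_shift mu_inv n' mA).
Qed.

Lemma mean_growthD n n' : mean_growth (n + n') <= mean_growth n + mean_growth n'.
Proof.
have mf i : measurable_fun setT (EFin \o log_growth i).
  by apply/measurable_EFinP; exact: measurable_log_growth.
have mfi : measurable_fun setT (fun w => (log_growth n (iter n' T w))%:E).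
  exact: measurableT_comp (mf n) (measurable_shift n').
have f0 i w : (0 <= (log_growth i w)%:E)%E by rewrite lee_fin log_growth_ge0.
have shifted := etrans (mean_growthE n) (esym (integral_log_growth_iter n n')).
rewrite -lee_fin EFinD [leLHS]mean_growthE.
rewrite [X in (_ <= X + _)%E]shifted [X in (_ <= _ + X)%E]mean_growthE.
rewrite -[leRHS]ge0_integralD//; last exact: mf.
apply: ge0_le_integral => //; first exact: mf.
  by apply: emeasurable_funD => //; exact: mf.
by move=> w _; rewrite -EFinD lee_fin log_growthD.
Qed.

Lemma lyapunov_cvg : cvgn (fun n => n%:R^-1 * mean_growth n).
Proof.
apply: fekete_cvg; [exact: mean_growth_ge0|exact: mean_growthD].
Qed.

Lemma lyapunov_ge (c : R) : (forall n, n%:R * c <= mean_growth n) ->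
  c <= lyapunov mu v lambda E.
Proof.
move=> H; apply: limr_ge; first exact: lyapunov_cvg.
near=> n; have n0 : (0 < n)%N by near: n; exact: nbhs_infty_gt.
by rewrite ler_pdivlMl ?ltr0n// H.
Unshelve. all: by end_near. Qed.

(** Integral of [log_growth_ge].  When the constant on its left is negative the
    bound is weaker than nonnegativity of the growth, and is obtained from it, so
    that all integrands below are nonnegative. *)
Lemma mean_growth_ge (alpha H K q : R) : 0 < lambda -> 0 < alpha -> 0 < H ->
  0 <= K -> 0 <= q < 1 ->
  (forall n r, measurable (small_ratio v lambda E alpha H n r)) ->
  (forall n r, fine (mu (small_ratio v lambda E alpha H n r)) <= K * q ^+ r) ->
  forall n, n%:R * (ln (lambda * (H / 2)) - alpha * (K / (1 - q))) <= mean_growth n.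
Proof.
move=> lambda0 alpha0 H0 K0 q01 mbad bK n.
have D0 : 0 <= alpha * (K / (1 - q)).
  case/andP: q01 => _ q1.
  by rewrite mulr_ge0 ?(ltW alpha0)// divr_ge0// subr_ge0 ltW.
have [c0|c0] := ltP (n%:R * ln (lambda * (H / 2))) 0.
  rewrite (le_trans _ (mean_growth_ge0 n))// mulrBr.
  by rewrite subr_le0 (le_trans (ltW c0))// mulr_ge0.
rewrite mulrBr lerBlDr -lee_fin EFinD mean_growthE.
have mind i r : measurable_fun setT
    (fun w => (\1_(small_ratio v lambda E alpha H i r) w : R)%:E).
  by apply/measurable_EFinP; exact: measurable_indic.
have mS i : measurable_fun setT (small_ratio_count v lambda E alpha H i).
  by apply: ge0_emeasurable_sum => // r w _ _; rewrite lee_fin.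
have maS i : measurable_fun setT
    (fun w => (alpha%:E * small_ratio_count v lambda E alpha H i w)%E).
  by apply: measurable_funeM.
have aS0 i w : (0 <= alpha%:E * small_ratio_count v lambda E alpha H i w)%E.
  by rewrite mule_ge0 ?small_ratio_count_ge0// lee_fin ltW.
have mf : measurable_fun setT (EFin \o log_growth n).
  by apply/measurable_EFinP; exact: measurable_log_growth.
apply: (@le_trans _ _ (\int[mu]_w ((log_growth n w)%:E +
    \sum_(i < n) (alpha%:E * small_ratio_count v lambda E alpha H i w)))%E).
  rewrite -[leLHS]mule1 -(probability_setT mu) -integral_cst//.
  apply: ge0_le_integral => //.
  - apply: emeasurable_funD; first exact: mf.
    by apply: emeasurable_sum => i; exact: maS.
  - by move=> w _; exact: log_growth_ge.
rewrite ge0_integralD//; last 3 first.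
- by move=> w _; rewrite lee_fin log_growth_ge0.
- by move=> w _; rewrite sume_ge0.
- by apply: emeasurable_sum => i; exact: maS.
rewrite leeD2l// ge0_integral_sum//.
rewrite mulr_natl -[X in X *+ n]mul1r -[n in X in (_ <= X)%E]card_ord.
rewrite mul1r -sumr_const -sumEFin; apply: lee_sum => i _.
rewrite ge0_integralZl//; last 2 first.
- by move=> w _; exact: small_ratio_count_ge0.
- by rewrite lee_fin ltW.
rewrite EFinM lee_pmul2l ?lte_fin//.
rewrite integral_nneseries//.
apply: nneseries_geometric => // r.
rewrite integral_indic// setIT measure_ge0/= -fin_prob// lee_fin.
exact: bK.
Qed.

End mean_growth.

Theorem theorem2 (R : realType) (ell : nat) (ell_ge2 : (2 <= ell)%N)
  (k : nat) (F : {set k.-tuple 'I_ell}) (F0 : sft_plus F !=set0)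
  (mu : probability (half_line R F0) R)
  (mu_inv : shift_invariant mu)
  (mu_supp : fully_supported mu)
  (mu_bdp : bounded_distortion mu)
  (mu_nonatomic : nonatomic mu)
  (alpha : R) (alpha_gt0 : 0 < alpha)
  (v : half_line R F0 -> R)
  (v_anti_holder : anti_holder alpha v)
  (v_continuous : continuous v)
  (v_bounded : bounded_fun v)
  (v_monotone : dict_monotone v) :
  exists2 C1 : R, 0 < C1 &
    forall lambda : R, 0 < lambda ->
    forall E : R, lyapunov mu v lambda E > ln lambda - C1.
Proof.
have [H H0 vH] := v_anti_holder.
have [gamma gamma1 cat] := prob_cyl_cat mu_inv mu_bdp.
have [kappa kappa0 decay] := prob_cyl_decay mu_inv mu_bdp mu_nonatomic.
have q1 : expR (- kappa) < 1 by rewrite -expR0 ltr_expR oppr_lt0.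
set K := 2 * gamma * (gap_bound gamma kappa + 1).
have K0 : 0 <= K.
  rewrite !mulr_ge0 ?addr_ge0 ?(gap_bound_ge0 gamma1 kappa0)//.
  exact: le_trans gamma1.
set D := alpha * (K / (1 - expR (- kappa))).
have D0 : 0 <= D.
  by rewrite mulr_ge0 ?(ltW alpha_gt0)// divr_ge0// subr_ge0 ltW.
exists (D + `|ln (H / 2)| + 1).
  by rewrite ltr_wpDl// addr_ge0.
move=> lambda lambda0 E.
have : ln (lambda * (H / 2)) - D <= lyapunov mu v lambda E.
  apply: lyapunov_ge => //.
  apply: mean_growth_ge => //.
  - by rewrite expR_ge0.
  - by move=> n r; exact: measurable_small_ratio.
  - move=> n r.
    have -> : expR (- kappa) ^+ r = expR (- (kappa * r%:R)).
      by rewrite -expRM_natl mulrC mulNr.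
    exact: (prob_small_ratio gamma1).
rewrite lnM ?posrE ?divr_gt0//; apply: lt_le_trans.
have := ler_norm (- ln (H / 2)); rewrite normrN.
by move: (ln (H / 2)) => h; lra.
Qed.
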